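(* Let $z>0$, let $\widetilde{\mathcal L}=\mathcal O(\sum_{i=1}^rc_i\widetilde{\mathcal D}_i)$ be a real equivariant Picard element, i.e. $c=(c_1,\dots,c_r)\in\mathbb R^r$, and let $F_{\widetilde{\mathcal L}}=\prod_{i=1}^r(\mathbb R+2\pi\sqrt{-1}c_i)\subset\mathbb C^r$ be its mirror Lagrangian cycle. Let $c'\in\mathbb R^r$ be a deformation of $c$ with $|c'_i-c_i|<\frac14$ for all $i$, put $F_{\widetilde{\mathcal L}'}=\prod_{i=1}^r(\mathbb R+2\pi\sqrt{-1}c'_i)$, and let $t\in\mathbb C^k$ satisfy $$\sum_{i=1}^rl_i^{(a)}\Big(2\pi c_i-\frac\pi2\Big)<\mathrm{Im}(t_a)=2\pi\sum_{i=1}^rl_i^{(a)}c_i'<\sum_{i=1}^rl_i^{(a)}\Big(2\pi c_i+\frac\pi2\Big),\qquad a=1,\dots,k.$$ Then $$\mathfrak F^{-1}_u\big(Z_B^{\widetilde M_{\mathbb C},G}(F_{\widetilde{\mathcal L}})\big)=Z_B^{\mathcal X}\Big(F_{\widetilde{\mathcal L}'}\cap\bigcap_{a=1}^k\{\mathrm{Re}\,\widetilde H_a=\mathrm{Re}(t_a)\}\Big).$$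
   Context: **Toric data.** $N\cong\mathbb Z^n$; $\Sigma$ is a complete simplicial fan in $N_{\mathbb R}$ with rays $\mathbb R_{\ge0}b_i$, $b_i\in N$, $i=1,\dots,r'$; $b_{r'+1},\dots,b_r\in N$ are additional vectors such that $b_1,\dots,b_r$ generate $N$. $\widetilde N=\bigoplus_{i=1}^r\mathbb Z\tilde b_i\to N$, $\tilde b_i\mapsto b_i$, has kernel $\mathbb L\cong\mathbb Z^k$, $k=r-n$; $\widetilde M=\mathrm{Hom}(\widetilde N,\mathbb Z)$; $D_i\in\mathbb L^\vee$ is the restriction to $\mathbb L$ of the $i$-th coordinate function on $\widetilde N$. $\widetilde{\mathcal D}_i=\{Z_i=0\}\subset\mathbb C^r$; real equivariant Picard elements $\mathcal O(\sum c_i\widetilde{\mathcal D}_i)$ are identified with elements of $\widetilde M_{\mathbb R}\cong\mathbb R^r$. $G=\mathbb L\otimes\mathbb C^*$ acts on $\mathbb C^r$ with weights $D_i$, and $\mathcal X$ is the associated $n$-dimensional toric orbifold of the stacky fan $(\Sigma,(b_1,\dots,b_{r'}))$, a GIT quotient of $\mathbb C^r$ by $G$. For an $n$-dimensional cone $\sigma$ let $I_\sigma=\{i\in\{1,\dots,r\}:\mathbb R_{\ge0}b_i\text{ is not one of the rays }(i\le r')\text{ of }\sigma\}$ (so $I_\sigma\supset\{r'+1,\dots,r\}$) and $\widetilde{\mathrm{Nef}}_{\mathcal X}=\bigcap_\sigma\sum_{i\in I_\sigma}\mathbb R_{\ge0}D_i$, whose interior is the extended Kähler cone. Standing assumption: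 the coarse moduli space of $\mathcal X$ is a Fano toric variety and $D_1+\dots+D_r$ lies in the closure of the extended Kähler cone. Fix an integral basis $p_1,\dots,p_k$ of $\mathbb L^\vee$ lying in $\widetilde{\mathrm{Nef}}_{\mathcal X}$ with $p_{k'+1},\dots,p_k\in\sum_{i>r'}\mathbb R_{\ge0}D_i$, where $k'=k-(r-r')$; define $l_i^{(a)}\in\mathbb Z$ by $D_i=\sum_al_i^{(a)}p_a$. **B-model.** On $\widetilde M_{\mathbb C}=\mathbb C^r$ with coordinates $x_i$ put $X_i=e^{x_i}$ and $\widetilde H_a=\sum_il_i^{(a)}x_i$. With equivariant parameters $\lambda_a$, $\mathrm{Re}(\lambda_a)>0$, and $u_a=\lambda_a/z$, the $G$-equivariant superpotential is $W_G^{\mathbb C^r}=\sum_iX_i-\sum_a\lambda_a\widetilde H_a$, and $$Z_B^{\widetilde M_{\mathbb C},G}(F)=\int_Fe^{-W_G^{\mathbb C^r}/z}\,dx_1\cdots dx_r=\int_Fe^{-\sum_iX_i/z+\sum_au_a\widetilde H_a}\,dx_1\cdots dx_r,$$ regarded as a function of $u=(u_1,\dots,u_k)$. For $t\in\mathbb C^k$, $\widetilde{\mathcal Y}_t=\{\widetilde H_a=t_a\ \forall a\}$, $\Omega_{\widetilde{\mathcal Y}_t}=\frac{dx_1\cdots dx_r}{d\widetilde H_1\wedge\dots\wedge d\widetilde H_k}$ (an orientation convention such as $dx_1\cdots dx_r=\Omega_{\widetilde{\mathcal Y}_t}\wedge d\widetilde H_1\wedge\dots\wedge d\widetilde H_k$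 is fixed; the precise choice plays no role), $W^{\mathcal X}=\sum_iX_i$ and, for a submanifold $F\subset\widetilde{\mathcal Y}_t$ of real dimension $n$, $Z_B^{\mathcal X}(F)=\int_Fe^{-W^{\mathcal X}/z}\Omega_{\widetilde{\mathcal Y}_t}$. The set on the right-hand side of the claim lies in $\widetilde{\mathcal Y}_t$. **Inverse Fourier transform.** $\mathfrak F_u^{-1}(f)(t)=(2\pi\sqrt{-1})^{-k}\int_{\gamma+\sqrt{-1}\mathbb R^k}f(u)e^{-\sum_au_at_a}\,du_1\cdots du_k$, with $\gamma=\mathrm{Re}(u)$ in the positive orthant $(0,\infty)^k$.
   Formalization: Added assumption: for Re(u)=γ the equivariant integral Z_B converges absolutely on both F_L and F_{L'}. For general real c (e.g. c_i=1/2) or some γ in the positive orthant the integrals diverge. The cycle on the right is oriented so that Ω is positive. *)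

(* Defs.v *)
From HB Require Import structures.
From mathcomp Require Import all_boot all_order all_algebra.
From mathcomp Require Import all_classical all_reals all_analysis.
From mathcomp Require Import complex.

Set Implicit Arguments.
Unset Strict Implicit.
Unset Printing Implicit Defensive.

Import Order.TTheory GRing.Theory Num.Theory.
Import numFieldNormedType.Exports.

Local Open Scope classical_set_scope.
Local Open Scope ring_scope.
Local Open Scope complex_scope.

Definition relations n r (b : 'M[int]_(r, n)) : set 'rV[int]_r :=
  [set beta | beta *m b = 0].

Definition mxR (R : realType) m n (A : 'M[int]_(m, n)) : 'M[R]_(m, n) :=
  map_mx intr A.

Definition mxC (R : realType) m n (A : 'M[int]_(m, n)) : 'M[R[i]]_(m, n) :=
  map_mx intr A.

(* Cone spanned over the nonnegative reals by the rows of g with index in I. *)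
Definition cone (R : realType) r m (g : 'M[R]_(r, m)) (I : {set 'I_r}) :
    set 'rV[R]_m :=
  [set v | exists x : 'rV[R]_r, [/\ forall i, 0 <= x 0 i,
     forall i, i \notin I -> x 0 i = 0 & v = x *m g]].

(* A simplicial fan is encoded by the sets of indices of the rays of its cones;
   row i of b is b_i, and the rays of the fan are those of b_0, ..., b_(r'-1). *)
Record complete_simplicial_fan (R : realType) n r (r' : nat)
    (b : 'M[int]_(r, n)) (Sigma : {set {set 'I_r}}) : Prop := {
  fan_rays : forall i : 'I_r, ([set i]%SET \in Sigma) = (i < r')%N;
  fan_face : forall s s' : {set 'I_r},
    s \in Sigma -> s' \subset s -> s' \in Sigma;
  fan_simplicial : forall s : {set 'I_r}, s \in Sigma ->
    forall x : 'rV[R]_r, (forall i, i \notin s -> x 0 i = 0) ->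
    x *m mxR R b = 0 -> x = 0;
  fan_inter : forall s s' : {set 'I_r}, s \in Sigma -> s' \in Sigma ->
    cone (mxR R b) s `&` cone (mxR R b) s' = cone (mxR R b) (s :&: s')%SET;
  fan_complete : forall v : 'rV[R]_n,
    exists2 s, s \in Sigma & cone (mxR R b) s v }.

Definition maximal_cones n r (Sigma : {set {set 'I_r}}) : {set {set 'I_r}} :=
  [set s in Sigma | #|s| == n]%SET.

Definition generates n r (b : 'M[int]_(r, n)) : Prop :=
  forall v : 'rV[int]_n, exists x : 'rV[int]_r, v = x *m b.

Definition primitive_generator n r (b : 'M[int]_(r, n)) (i : 'I_r) :
    'rV[int]_n :=
  \row_j (b i j %/ (\big[gcdn/0%N]_j' `|b i j'|%N)%:Z)%Z.

(* The anticanonical divisor of the toric variety of the fan (the sum of the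
   torus invariant prime divisors) is Q-Cartier and ample: its local equation
   m on each maximal cone equals 1 on the primitive generators of the rays of
   that cone, and its support function is strictly convex. *)
Definition fano (R : realType) n r (r' : nat) (b : 'M[int]_(r, n))
    (Sigma : {set {set 'I_r}}) : Prop :=
  forall s, s \in maximal_cones n Sigma ->
  exists m : 'cV[R]_n, forall i : 'I_r, (i < r')%N ->
    if i \in s then (mxR R (primitive_generator b i) *m m) 0 0 = 1
    else (mxR R (primitive_generator b i) *m m) 0 0 < 1.

(* Elements of the dual of the lattice of relations are represented by
   functions on 'rV[int]_r, which matter only on the relations. *)
Definition functional n r (b : 'M[int]_(r, n)) (f : 'rV[int]_r -> int) :
    Prop :=
  forall x y, relations b x -> relations b y -> f (x + y) = f x + f y.

Definition integral_basis n r k (b : 'M[int]_(r, n))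
    (p : 'I_k -> 'rV[int]_r -> int) : Prop :=
  (forall a, functional b (p a)) /\
  forall f, functional b f -> exists! m : 'rV[int]_k,
    forall beta, relations b beta -> f beta = \sum_a m 0 a * p a beta.

(* D_i = \sum_a l_i^(a) p_a, where D_i is the i-th coordinate function. *)
Definition charges n r k (b : 'M[int]_(r, n)) (p : 'I_k -> 'rV[int]_r -> int)
    (l : 'M[int]_(r, k)) : Prop :=
  forall i beta, relations b beta -> beta 0 i = \sum_a l i a * p a beta.

(* The real dual of the lattice of relations is identified with 'rV[R]_k by
   coordinates in the basis p, so that D_i is row i of l. *)
Definition nef_cone (R : realType) n r k (Sigma : {set {set 'I_r}})
    (l : 'M[int]_(r, k)) : set 'rV[R]_k :=
  [set xi | forall s, s \in maximal_cones n Sigma ->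
     cone (mxR R l) (~: s)%SET xi].

(* The extended Kaehler cone is the interior of the nef cone. *)
Record toric_data (R : realType) (n k r' : nat) (b : 'M[int]_(n + k, n))
    (Sigma : {set {set 'I_(n + k)}}) (p : 'I_k -> 'rV[int]_(n + k) -> int)
    (l : 'M[int]_(n + k, k)) : Prop := {
  td_rays : (r' <= n + k)%N;
  td_fan : complete_simplicial_fan R r' b Sigma;
  td_generates : generates b;
  td_fano : fano R r' b Sigma;
  td_basis : integral_basis b p;
  td_charges : charges b p l;
  td_nef : closure (interior (nef_cone n Sigma l)) (\sum_i row i (mxR R l));
  td_basis_nef : forall a : 'I_k, nef_cone n Sigma l (delta_mx 0 a : 'rV[R]_k);
  td_basis_ext : forall a : 'I_k, (k - (n + k - r') <= a)%N ->
    cone (mxR R l) [set i : 'I_(n + k) | (r' <= i)%N]%SET (delta_mx 0 a) }.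

Definition cexp (R : realType) (w : R[i]) : R[i] :=
  (expR (complex.Re w) * cos (complex.Im w)) +i*
  (expR (complex.Re w) * sin (complex.Im w)).

(* The m-fold product of a sigma-finite measure. *)
Section tuple_measure.
Context d (T : measurableType d) (R : realType).
Variable mu : {sigma_finite_measure set T -> \bar R}.
Local Open Scope ereal_scope.

Section step.
Context (m : nat).
Variable nu : {sigma_finite_measure set (m.-tuple T) -> \bar R}.

Definition cons_pair (x : T * m.-tuple T) : m.+1.-tuple T :=
  [tuple of x.1 :: x.2].

Definition cons_measure : set (m.+1.-tuple T) -> \bar R :=
  pushforward (mu \x nu) cons_pair.

Let mcons_pair A : measurable A -> measurable (cons_pair @^-1` A).
Proof. by rewrite -[X in _ -> measurable X]setTI; exact: measurable_cons. Qed.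

Let cons_measure0 : cons_measure set0 = 0.
Proof. by rewrite /cons_measure /pushforward preimage_set0 measure0. Qed.

Let cons_measure_ge0 A : 0 <= cons_measure A.
Proof. by rewrite /cons_measure /pushforward; apply: measure_ge0. Qed.

Let cons_measure_sigma_additive : semi_sigma_additive cons_measure.
Proof.
move=> F mF tF mUF; rewrite /cons_measure /pushforward preimage_bigcup.
apply: measure_semi_sigma_additive.
- by move=> i; exact: mcons_pair.
- apply/trivIsetP => /= i j _ _ ij; rewrite -preimage_setI.
  by move/trivIsetP : tF => /(_ _ _ _ _ ij) ->//; rewrite preimage_set0.
- by rewrite -preimage_bigcup; exact: mcons_pair.
Qed.

HB.instance Definition _ := isMeasure.Build _ _ _ cons_measure
  cons_measure0 cons_measure_ge0 cons_measure_sigma_additive.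

Let cons_measure_sigma_finite : sigma_finite setT cons_measure.
Proof.
have /sigma_finiteP[F [TF ndF Foo]] := sigma_finiteT mu.
have /sigma_finiteP[G [TG ndG Goo]] := sigma_finiteT nu.
pose u (s : m.+1.-tuple T) := (thead s, [tuple of behead s]).
have mu_ : measurable_fun setT u.
  by apply: measurable_fun_pair; [exact: measurable_tnth|
                                  exact: measurable_behead].
have uK x : u (cons_pair x) = x.
  by case: x => x s; rewrite /u /cons_pair /= theadE; congr pair; exact/val_inj.
exists (fun i => u @^-1` (F i `*` G i)).
  apply/seteqP; split=> // s _.
  have [i _ Fi] : (\bigcup_i F i) (u s).1 by rewrite -TF.
  have [j _ Gj] : (\bigcup_i G i) (u s).2 by rewrite -TG.
  exists (maxn i j) => //; split.
    exact: (subsetPset _ _ (ndF _ _ (leq_maxl i j))) Fi.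
  exact: (subsetPset _ _ (ndG _ _ (leq_maxr i j))) Gj.
move=> i; have [mFi Fi] := Foo i; have [mGi Gi] := Goo i.
have mFG : measurable (F i `*` G i) by exact: measurableX.
split; first by rewrite -[X in measurable X]setTI; exact: mu_.
rewrite /cons_measure /pushforward -comp_preimage.
rewrite (_ : u \o cons_pair = id) ?preimage_id; last exact/funext.
by rewrite product_measure1E// lte_mul_pinfty// ge0_fin_numE.
Qed.

HB.instance Definition _ := @Measure_isSigmaFinite.Build _ _ _
  cons_measure cons_measure_sigma_finite.

End step.

Fixpoint tuple_measure (m : nat) :
    {sigma_finite_measure set (m.-tuple T) -> \bar R} :=
  match m with
  | 0 => [the sigma_finite_measure _ _ of @dirac _ (0.-tuple T) [tuple] R]
  | m'.+1 => [the sigma_finite_measure _ _ of cons_measure (tuple_measure m')]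
  end.

End tuple_measure.

Definition lebesgue_tuple (R : realType) (m : nat) :
    {sigma_finite_measure set (m.-tuple (measurableTypeR R)) -> \bar R} :=
  tuple_measure (@lebesgue_measure R) m.

Definition cintegrable (R : realType) m
    (f : m.-tuple (measurableTypeR R) -> R[i]) : Prop :=
  (lebesgue_tuple R m).-integrable setT (fun s => (complex.Re (f s))%:E) /\
  (lebesgue_tuple R m).-integrable setT (fun s => (complex.Im (f s))%:E).

Definition cintegral (R : realType) m
    (f : m.-tuple (measurableTypeR R) -> R[i]) : R[i] :=
  Rintegral (lebesgue_tuple R m) setT (fun s => complex.Re (f s)) +i*
  Rintegral (lebesgue_tuple R m) setT (fun s => complex.Im (f s)).

(* An affine real m-plane in C^d: a base point and the m rows of a frame. It is
   oriented by the frame if [reversed] is false, oppositely to it otherwise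
   (this gives both orientations of a point, the case m = 0). *)
Record affine_cycle (R : realType) (m d : nat) := AffineCycle {
  base : 'rV[R[i]]_d;
  frame : 'M[R[i]]_(m, d);
  reversed : bool }.

Definition parametrization (R : realType) m d (F : affine_cycle R m d)
    (s : m.-tuple R) : 'rV[R[i]]_d :=
  base F + (\row_j (tnth s j)%:C) *m frame F.

Definition locus (R : realType) m d (F : affine_cycle R m d) :
    set 'rV[R[i]]_d :=
  range (parametrization F).

Definition sign (R : realType) m d (F : affine_cycle R m d) : R[i] :=
  (-1) ^+ reversed F.

(* The integral over F of the form g w, where w is an m-form with constant
   coefficients, given by its value on frames. *)
Definition form_integrable (R : realType) m d (w : 'M[R[i]]_(m, d) -> R[i])
    (g : 'rV[R[i]]_d -> R[i]) (F : affine_cycle R m d) : Prop :=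
  cintegrable (fun s => g (parametrization F s) * w (frame F)).

Definition form_integral (R : realType) m d (w : 'M[R[i]]_(m, d) -> R[i])
    (g : 'rV[R[i]]_d -> R[i]) (F : affine_cycle R m d) : R[i] :=
  sign F * cintegral (fun s => g (parametrization F s) * w (frame F)).

(* dx_1 ... dx_d *)
Definition volume_form (R : realType) d (V : 'M[R[i]]_d) : R[i] := \det V.

Definition Htilde (R : realType) r k (l : 'M[int]_(r, k)) (x : 'rV[R[i]]_r) :
    'rV[R[i]]_k :=
  x *m mxC R l.

(* The form dx_1 ... dx_r / dH_1 ... dH_k on tangent frames of the fibres of
   Htilde: the contraction of dx_1 ... dx_r with vectors w_1, ..., w_k (the rows
   of the pseudo-inverse) such that dH_a(w_b) = delta_ab. *)
Definition Omega (R : realType) n k (l : 'M[int]_(n + k, k))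
    (V : 'M[R[i]]_(n, n + k)) : R[i] :=
  volume_form (col_mx V (pinvmx (mxC R l))).

(* dx_1 ... dx_r = Omega /\ dH_1 /\ ... /\ dH_k, evaluated on vectors of which
   the first n are tangent to a fibre of Htilde. *)
Lemma volume_form_Omega (R : realType) n k (l : 'M[int]_(n + k, k))
    (V : 'M[R[i]]_(n, n + k)) (W : 'M[R[i]]_(k, n + k)) :
  row_full (mxC R l) -> V *m mxC R l = 0 ->
  volume_form (col_mx V W) = Omega l V * \det (W *m mxC R l).
Proof.
set A := mxC R l => Afull VA; rewrite /Omega /volume_form -/A.
have rA : \rank A = k by apply/eqP.
have [Vfree|Vnfree] := boolP (row_free V); last first.
  suff det0 (X : 'M[R[i]]_(k, n + k)) : \det (col_mx V X) = 0.
    by rewrite !det0 mul0r.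
  apply/eqP; apply: contraNT Vnfree; rewrite -unitfE => detV.
  have : col_mx V X \in unitmx by [].
  rewrite -row_free_unit /row_free -addsmxE => /eqP rVX.
  rewrite eqn_leq rank_leq_row -(leq_add2r k) -{1}rVX.
  by apply: leq_trans (mxrank_adds_leqif _ _) _; rewrite leq_add2l rank_leq_row.
have VK : (V == kermx A)%MS.
  rewrite -mxrank_leqif_eq; last by rewrite sub_kermx VA.
  by rewrite mxrank_ker rA addnK; exact: Vfree.
have AA : pinvmx A *m A = 1%:M by rewrite mulVpmx.
have : (W - (W *m A) *m pinvmx A <= V)%MS.
  by rewrite (eqmxP VK) sub_kermx mulmxBl -(mulmxA (W *m A)) AA mulmx1 subrr.
case/submxP => X WX.
rewrite (_ : col_mx V W =
    block_mx 1%:M 0 X (W *m A) *m col_mx V (pinvmx A)); last first.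
  by rewrite mul_block_col !mul1mx mul0mx addr0 -WX subrK.
by rewrite det_mulmx det_lblock det1 mul1r mulrC.
Qed.

Definition superpotential (R : realType) r (x : 'rV[R[i]]_r) : R[i] :=
  \sum_i cexp (x 0 i).

Definition equivariant_superpotential (R : realType) r k (l : 'M[int]_(r, k))
    (lambda : 'rV[R[i]]_k) (x : 'rV[R[i]]_r) : R[i] :=
  superpotential x - \sum_a lambda 0 a * Htilde l x 0 a.

(* As functions of u, where lambda = z u. *)
Definition ZB_equivariant_integrand (R : realType) r k (l : 'M[int]_(r, k))
    (z : R) (u : 'rV[R[i]]_k) (x : 'rV[R[i]]_r) : R[i] :=
  cexp (- equivariant_superpotential l (z%:C *: u) x / z%:C).

(* On a cycle mirror_cycle c (below) the modulus of the integrand is a product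
   over i, and the integral converges absolutely if and only if, for all i,
   X_i has positive real part on the cycle and \sum_a l_i^(a) Re u_a > 0. If c
   is integral the first condition holds, and it persists for all c' with
   |c'_i - c_i| < 1/4; for an arbitrary real c it may fail. *)
Definition ZB_equivariant_converges (R : realType) r k (l : 'M[int]_(r, k))
    (z : R) (F : affine_cycle R r r) (u : 'rV[R[i]]_k) : Prop :=
  form_integrable (@volume_form R r) (ZB_equivariant_integrand l z u) F.

Definition ZB_equivariant (R : realType) r k (l : 'M[int]_(r, k)) (z : R)
    (F : affine_cycle R r r) (u : 'rV[R[i]]_k) : R[i] :=
  form_integral (@volume_form R r) (ZB_equivariant_integrand l z u) F.

Definition ZB_integrand (R : realType) r (z : R) (x : 'rV[R[i]]_r) : R[i] :=
  cexp (- superpotential x / z%:C).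

Definition ZB_converges (R : realType) n k (l : 'M[int]_(n + k, k)) (z : R)
    (F : affine_cycle R n (n + k)) : Prop :=
  form_integrable (Omega l) (ZB_integrand z) F.

Definition ZB (R : realType) n k (l : 'M[int]_(n + k, k)) (z : R)
    (F : affine_cycle R n (n + k)) : R[i] :=
  form_integral (Omega l) (ZB_integrand z) F.

(* The product of the lines R + 2 pi i c_j, with the orientation of R^r. *)
Definition mirror_cycle (R : realType) r (c : 'rV[R]_r) : affine_cycle R r r :=
  AffineCycle (\row_i (0 +i* (2 * pi * c 0 i))) 1%:M false.

(* gamma + i R^k, with orientation such that du = i^k ds_1 ... ds_k. *)
Definition vertical_cycle (R : realType) k (gamma : 'rV[R]_k) :
    affine_cycle R k k :=
  AffineCycle (\row_a (gamma 0 a)%:C) ('i%:M) false.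

Definition fourier_integrand (R : realType) k (f : 'rV[R[i]]_k -> R[i])
    (t u : 'rV[R[i]]_k) : R[i] :=
  f u * cexp (- \sum_a u 0 a * t 0 a).

Definition inverse_fourier_converges (R : realType) k (gamma : 'rV[R]_k)
    (f : 'rV[R[i]]_k -> R[i]) (t : 'rV[R[i]]_k) : Prop :=
  form_integrable (@volume_form R k) (fourier_integrand f t)
    (vertical_cycle gamma).

Definition inverse_fourier (R : realType) k (gamma : 'rV[R]_k)
    (f : 'rV[R[i]]_k -> R[i]) (t : 'rV[R[i]]_k) : R[i] :=
  (0 +i* (2 * pi)) ^- k *
  form_integral (@volume_form R k) (fourier_integrand f t)
    (vertical_cycle gamma).

(* Main.v *)
Require Import Defs.
From HB Require Import structures.
From mathcomp Require Import all_boot all_order all_algebra.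
From mathcomp Require Import all_classical all_reals all_analysis.
From mathcomp Require Import measurable_realfun complex.
From mathcomp Require Import ring lra.

Set Implicit Arguments.
Unset Strict Implicit.
Unset Printing Implicit Defensive.

Import Order.TTheory GRing.Theory Num.Theory.
Import numFieldNormedType.Exports.

Local Open Scope classical_set_scope.
Local Open Scope ring_scope.
Local Open Scope complex_scope.

(** Write [x_i = s_i + 2 pi i c_i] on the mirror cycle and
    [w_i = sum_a l_i^(a) u_a]. The integrand of the equivariant integral is the
    product over [i] of [exp (- exp x_i / z + w_i x_i)], so the integral is a
    product of Gamma integrals along lines rotated by the angles [2 pi c_i].
    Its absolute convergence forces [Re w_i > 0] and [cos (2 pi c_i) > 0]
    ([rotE_prod_converges]).

    Since [c'_i] is within [1/4] of [c_i], the cosine stays positive between the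
    two angles ([min_cos_le]), and Cauchy's theorem replaces [c] by [c']
    ([Cintegral_rotE_shift]). Rotating a little further, in either direction,
    also shows that the factors decay exponentially in [Im w_i]
    ([fourier_rotG_decay]), which makes the inverse Fourier integral converge.

    On [u = gamma + i v], the rotation produces a factor
    [exp (- 2 pi sum_i c'_i Im w_i)]. By the choice of [Im t] it is cancelled by
    the modulus of [exp (- u.t)]. What remains to invert is the Fourier
    transform of the function [prod_i g_i (s_i)] on [R^r], with
    [g_i (s) = exp (- exp (s + 2 pi i c'_i) / z + Re w_i s)], restricted to the
    frequencies [v L^T], where [L] is the matrix of the [l_i^(a)]. Inverting the
    restriction of a Fourier transform to a subspace integrates the function
    over a fibre of the dual projection, here over [{s | s L = Re t}]
    ([slice_inversion]). The proof inserts [exp (- e |v|)], exchanges the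
    integrals, recognises a product of Poisson kernels in [s L - Re t], passes
    to coordinates [y] along the fibre and [h] across it, and lets [e] tend to
    [0].

    That fibre is the given cycle: its frame is real and tangent to the fibres
    of [L], and [Omega] of the frame is the Jacobian determinant of the
    coordinates [(y, h)] ([cycle_pointE], [cycle_sign]). On it,
    [exp (sum_i Re w_i x_i)] is constant and compensates [exp (- gamma . t)]. *)

Local Notation normc := ComplexField.Normc.normc.
Local Notation cRe := complex.Re.
Local Notation cIm := complex.Im.

(** * Complex-valued integrals *)

Section modulus.
Context {R : realType}.
Implicit Types a x y : R[i].

Lemma Re_mul x y : cRe (x * y) = cRe x * cRe y - cIm x * cIm y.
Proof. by case: x y => ? ? [] ? ?. Qed.

Lemma Im_mul x y : cIm (x * y) = cRe x * cIm y + cIm x * cRe y.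
Proof. by case: x y => ? ? [] ? ?. Qed.

Lemma ReD x y : cRe (x + y) = cRe x + cRe y.
Proof. by case: x y => ? ? [] ? ?. Qed.

Lemma ImD x y : cIm (x + y) = cIm x + cIm y.
Proof. by case: x y => ? ? [] ? ?. Qed.

Lemma ReN x : cRe (- x) = - cRe x. Proof. by case: x. Qed.

Lemma ImN x : cIm (- x) = - cIm x. Proof. by case: x. Qed.

Lemma eq_ReIm x y : cRe x = cRe y -> cIm x = cIm y -> x = y.
Proof. by case: x y => ? ? [] ? ? /= -> ->. Qed.

Lemma normc_ge0 x : 0 <= normc x.
Proof. by case: x => ? ?; rewrite sqrtr_ge0. Qed.

Lemma Re_le_normc x : `|cRe x| <= normc x.
Proof.
by case: x => u v /=; rewrite -sqrtr_sqr ler_wsqrtr// lerDl sqr_ge0.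
Qed.

Lemma Im_le_normc x : `|cIm x| <= normc x.
Proof.
by case: x => u v /=; rewrite -sqrtr_sqr ler_wsqrtr// lerDr sqr_ge0.
Qed.

Lemma normc_le_ReIm x : normc x <= `|cRe x| + `|cIm x|.
Proof.
case: x => u v /=; rewrite -(@ler_pXn2r _ 2) ?nnegrE ?sqrtr_ge0 ?addr_ge0//.
rewrite sqr_sqrtr ?addr_ge0 ?sqr_ge0// sqrrD !real_normK ?num_real//.
by rewrite addrAC lerDl mulrn_wge0// mulr_ge0.
Qed.

Lemma normc_prod m (f : 'I_m -> R[i]) :
  normc (\prod_i f i) = \prod_i normc (f i).
Proof.
elim/big_rec2 : _ => [|i x y _ <-]; first exact: ComplexField.Normc.normc1.
by rewrite ComplexField.Normc.normcM.
Qed.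

Lemma normc_real (x : R) : normc x%:C = `|x|.
Proof. by rewrite /= expr0n addr0 sqrtr_sqr. Qed.

End modulus.

Section complex_integral.
Context d (T : measurableType d) (R : realType).
Implicit Types (mu : {measure set T -> \bar R}) (f g : T -> R[i]) (h : T -> R).

(** The integrals of the statement run over tuples; the proof also integrates
    over lines and over products of spaces, so the notions are needed for an
    arbitrary measure. *)
Definition cmeasurable f : Prop :=
  measurable_fun setT (fun x => cRe (f x)) /\
  measurable_fun setT (fun x => cIm (f x)).

Definition Cintegrable mu f : Prop :=
  mu.-integrable setT (fun x => (cRe (f x))%:E) /\
  mu.-integrable setT (fun x => (cIm (f x))%:E).

Definition Cintegral mu f : R[i] :=
  Rintegral mu setT (fun x => cRe (f x)) +i*
  Rintegral mu setT (fun x => cIm (f x)).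

Lemma eq_Cintegral mu f g : f =1 g -> Cintegral mu f = Cintegral mu g.
Proof. by move=> /funext ->. Qed.

Lemma eq_Cintegrable mu f g : f =1 g -> Cintegrable mu f -> Cintegrable mu g.
Proof. by move=> /funext ->. Qed.

Lemma cmeasurable_cst a : cmeasurable (cst a).
Proof. by split; exact: measurable_cst. Qed.

Lemma cmeasurable_mul f g :
  cmeasurable f -> cmeasurable g -> cmeasurable (fun x => f x * g x).
Proof.
move=> [fr fi] [gr gi]; split.
  under eq_fun do rewrite Re_mul.
  by apply: measurable_funB; apply: measurable_funM.
under eq_fun do rewrite Im_mul.
by apply: measurable_funD; apply: measurable_funM.
Qed.

Lemma cmeasurable_prod m (F : 'I_m -> T -> R[i]) :
  (forall i, cmeasurable (F i)) -> cmeasurable (fun x => \prod_i F i x).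
Proof.
move=> mF; elim: (index_enum _) => [|i s ih].
  under eq_fun do rewrite big_nil.
  exact: cmeasurable_cst.
under eq_fun do rewrite big_cons.
exact: cmeasurable_mul.
Qed.

Lemma cmeasurable_real h : measurable_fun setT h ->
  cmeasurable (fun x => (h x)%:C).
Proof. by move=> mh; split => //=; exact: measurable_cst. Qed.

Lemma cmeasurable_cexp f : cmeasurable f -> cmeasurable (fun x => cexp (f x)).
Proof.
move=> [fr fi]; split => /=.
  apply: measurable_funM; first exact: measurableT_comp.
  by apply: measurableT_comp => //; exact: continuous_measurable_fun (@continuous_cos R).
apply: measurable_funM; first exact: measurableT_comp.
by apply: measurableT_comp => //; exact: continuous_measurable_fun (@continuous_sin R).
Qed.

Lemma measurable_normc f : cmeasurable f ->
  measurable_fun setT (fun x => normc (f x)).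
Proof.
move=> [fr fi].
rewrite (_ : (fun x => _) =
    fun x => Num.sqrt (cRe (f x) ^+ 2 + cIm (f x) ^+ 2)); last first.
  by apply/funext => x; case: (f x).
apply: (measurableT_comp (continuous_measurable_fun (@sqrt_continuous R))).
by apply: measurable_funD; apply: measurable_funX.
Qed.

Lemma Cintegrable_measurable mu f : Cintegrable mu f -> cmeasurable f.
Proof.
by move=> [/measurable_int/measurable_EFinP ? /measurable_int/measurable_EFinP].
Qed.

Lemma Cintegrable_le mu f h : cmeasurable f ->
  mu.-integrable setT (EFin \o h) -> (forall x, normc (f x) <= h x) ->
  Cintegrable mu f.
Proof.
move=> [fr fi] ih fh; split.
  apply: (le_integrable measurableT _ _ ih); first exact/measurable_EFinP.
  move=> x _ /=; rewrite lee_fin (le_trans (Re_le_normc _))//.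
  by rewrite (le_trans (fh x))// ler_norm.
apply: (le_integrable measurableT _ _ ih); first exact/measurable_EFinP.
move=> x _ /=; rewrite lee_fin (le_trans (Im_le_normc _))//.
by rewrite (le_trans (fh x))// ler_norm.
Qed.

Lemma Cintegrable_normc mu f : Cintegrable mu f ->
  mu.-integrable setT (fun x => (normc (f x))%:E).
Proof.
move=> fi; have [fr fm] := fi.
have := integrableD measurableT (integrable_abse fr) (integrable_abse fm).
apply: le_integrable => //.
  exact/measurable_EFinP/measurable_normc/Cintegrable_measurable/fi.
move=> x _ /=; rewrite lee_fin ger0_norm ?normc_ge0//.
by rewrite (le_trans (normc_le_ReIm _))// ler_norm.
Qed.

Lemma CintegrableZ mu a f : Cintegrable mu f ->
  Cintegrable mu (fun x => a * f x).
Proof.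
move=> fi; apply: (@Cintegrable_le _ _ (fun x => normc a * normc (f x))).
- apply: cmeasurable_mul; first exact: cmeasurable_cst.
  exact: Cintegrable_measurable fi.
- exact: (integrableZl measurableT (normc a) (Cintegrable_normc fi)).
- by move=> x; rewrite ComplexField.Normc.normcM.
Qed.

Lemma CintegralZ mu a f : Cintegrable mu f ->
  Cintegral mu (fun x => a * f x) = a * Cintegral mu f.
Proof.
move=> [fr fi].
have Zl (r : R) (g : T -> R) : mu.-integrable setT (fun x => (g x)%:E) ->
    mu.-integrable setT (fun x => (r * g x)%:E).
  by move=> ig; apply: (integrableZl measurableT r ig).
apply: eq_ReIm.
  rewrite Re_mul /= -!RintegralZl// -RintegralB//; [|exact: Zl..].
  by apply: eq_Rintegral => x _; rewrite Re_mul.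
rewrite Im_mul /= -!RintegralZl// -RintegralD//; [|exact: Zl..].
by apply: eq_Rintegral => x _; rewrite Im_mul.
Qed.

Lemma le_normc_Cintegral mu f h : Cintegrable mu f ->
  mu.-integrable setT (EFin \o h) -> (forall x, normc (f x) <= h x) ->
  normc (Cintegral mu f) <= 2 * Rintegral mu setT h.
Proof.
move=> [fr fi] ih fh; apply: (le_trans (normc_le_ReIm _)).
rewrite mulr2n mulrDl !mul1r /=.
apply: lerD; apply: (le_trans (le_normr_Rintegral measurableT _)) => //.
  apply: le_Rintegral => //; first exact: integrable_norm.
  by move=> x _; rewrite (le_trans (Re_le_normc _)).
apply: le_Rintegral => //; first exact: integrable_norm.
by move=> x _; rewrite (le_trans (Im_le_normc _)).
Qed.

End complex_integral.

(** * Fubini, dominated convergence and images of measures *)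

Section fubini.
Context d1 d2 (T1 : measurableType d1) (T2 : measurableType d2) (R : realType).
Variable m1 : {sigma_finite_measure set T1 -> \bar R}.
Variable m2 : {sigma_finite_measure set T2 -> \bar R}.

Lemma integrable_mul_prod (g : T1 -> R) (h : T2 -> R) :
  m1.-integrable setT (EFin \o g) -> m2.-integrable setT (EFin \o h) ->
  (m1 \x m2)%E.-integrable setT (fun z => (g z.1 * h z.2)%:E).
Proof.
move=> ig ih.
have mg : measurable_fun setT g by apply/measurable_EFinP/measurable_int/ig.
have mh : measurable_fun setT h by apply/measurable_EFinP/measurable_int/ih.
apply/integrable12ltyP.
  by apply/measurable_EFinP/measurable_funM; exact: measurableT_comp.
under eq_integral => x _.
  under eq_integral => y _ do rewrite /= normrM EFinM.
  rewrite ge0_integralZl//; last first.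
    by apply/measurable_EFinP; exact: measurableT_comp.
  over.
rewrite ge0_integralZr//; last 2 first.
- by apply/measurable_EFinP; exact: measurableT_comp.
- exact: integral_ge0.
by apply: lte_mul_pinfty; [exact: integral_ge0| |];
  [rewrite ge0_fin_numE; [case/integrableP : ig|exact: integral_ge0]|
   case/integrableP : ih].
Qed.

(** Asking that every section be integrable makes the inner real integral agree
    with the extended one at every point, so that no null set has to be carried
    along. *)
Lemma Rintegral_fubini1 (f : T1 * T2 -> R) :
  (m1 \x m2)%E.-integrable setT (EFin \o f) ->
  (forall x, m2.-integrable setT (fun y => (f (x, y))%:E)) ->
  m1.-integrable setT (fun x => (Rintegral m2 setT (fun y => f (x, y)))%:E) /\
  Rintegral m1 setT (fun x => Rintegral m2 setT (fun y => f (x, y))) =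
  Rintegral (m1 \x m2)%E setT f.
Proof.
move=> fi fi2.
have E : (fun x => (Rintegral m2 setT (fun y => f (x, y)))%:E) =
    fubini_F m2 (EFin \o f).
  by apply/funext => x; rewrite /Rintegral fineK//; exact: integrable_fin_num.
split; first by rewrite E; exact: integrable_fubini_F fi.
by congr fine; rewrite E; exact: (integral12_prod_meas1 fi).
Qed.

Lemma Rintegral_fubini2 (f : T1 * T2 -> R) :
  (m1 \x m2)%E.-integrable setT (EFin \o f) ->
  (forall y, m1.-integrable setT (fun x => (f (x, y))%:E)) ->
  m2.-integrable setT (fun y => (Rintegral m1 setT (fun x => f (x, y)))%:E) /\
  Rintegral m2 setT (fun y => Rintegral m1 setT (fun x => f (x, y))) =
  Rintegral (m1 \x m2)%E setT f.
Proof.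
move=> fi fi1.
have E : (fun y => (Rintegral m1 setT (fun x => f (x, y)))%:E) =
    fubini_G m1 (EFin \o f).
  by apply/funext => x; rewrite /Rintegral fineK//; exact: integrable_fin_num.
split; last by congr fine; rewrite E; exact: (integral21_prod_meas1 fi).
rewrite E.
apply/integrableP; split; first exact: (measurable_fubini_G fi).
have mf := measurable_int _ fi.
apply: le_lt_trans ((integrable21ltyP _ _ mf).1 fi).
apply: ge0_le_integral => //.
- by apply: measurableT_comp => //; exact: (measurable_fubini_G fi).
- have := measurable_fun_fubini_tonelli_G (m1 := m1) (abse \o (EFin \o f)).
  by apply => [|z] //=; exact: (measurableT_comp _ mf).
- move=> y _; apply: le_abse_integral => //.
  by case/integrableP : (fi1 y).
Qed.

Lemma Cintegral_fubini1 (f : T1 * T2 -> R[i]) :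
  Cintegrable (m1 \x m2)%E f -> (forall x, Cintegrable m2 (fun y => f (x, y))) ->
  Cintegrable m1 (fun x => Cintegral m2 (fun y => f (x, y))) /\
  Cintegral m1 (fun x => Cintegral m2 (fun y => f (x, y))) =
  Cintegral (m1 \x m2)%E f.
Proof.
move=> [fr fi] f2.
have [ir er] := Rintegral_fubini1 fr (fun x => (f2 x).1).
have [ii ei] := Rintegral_fubini1 fi (fun x => (f2 x).2).
by split=> //; apply: eq_ReIm.
Qed.

Lemma Cintegral_fubini2 (f : T1 * T2 -> R[i]) :
  Cintegrable (m1 \x m2)%E f -> (forall y, Cintegrable m1 (fun x => f (x, y))) ->
  Cintegrable m2 (fun y => Cintegral m1 (fun x => f (x, y))) /\
  Cintegral m2 (fun y => Cintegral m1 (fun x => f (x, y))) =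
  Cintegral (m1 \x m2)%E f.
Proof.
move=> [fr fi] f1.
have [ir er] := Rintegral_fubini2 fr (fun x => (f1 x).1).
have [ii ei] := Rintegral_fubini2 fi (fun x => (f1 x).2).
by split=> //; apply: eq_ReIm.
Qed.

End fubini.

Section complex_limits.
Context {R : realType}.
Implicit Types (u v : nat -> R[i]) (l m : R[i]).

Definition ccvg u l : Prop :=
  (fun n => cRe (u n)) @ \oo --> cRe l /\ (fun n => cIm (u n)) @ \oo --> cIm l.

Lemma ccvg_unique u l m : ccvg u l -> ccvg u m -> l = m.
Proof.
move=> [ul ul'] [um um']; apply: eq_ReIm.
  exact: (cvg_unique _ ul um).
exact: (cvg_unique _ ul' um').
Qed.

Lemma ccvg_cst l : ccvg (fun=> l) l.
Proof. by split; exact: cvg_cst. Qed.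

Lemma ccvg_mul u v l m : ccvg u l -> ccvg v m ->
  ccvg (fun n => u n * v n) (l * m).
Proof.
move=> [ul ul'] [vm vm']; split.
  under eq_fun do rewrite Re_mul.
  by rewrite Re_mul; apply: cvgB; apply: cvgM.
under eq_fun do rewrite Im_mul.
by rewrite Im_mul; apply: cvgD; apply: cvgM.
Qed.

Lemma ccvg_prod (r : nat) (U : 'I_r -> nat -> R[i]) (L : 'I_r -> R[i]) :
  (forall i, ccvg (U i) (L i)) -> ccvg (fun n => \prod_i U i n) (\prod_i L i).
Proof.
move=> UL; elim: (index_enum _) => [|i s ih].
  under eq_fun do rewrite big_nil.
  by rewrite big_nil; exact: ccvg_cst.
under eq_fun do rewrite big_cons.
by rewrite big_cons; exact: ccvg_mul.
Qed.

End complex_limits.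

Lemma Rintegral_dominated d (T : measurableType d) (R : realType)
    (mu : {measure set T -> \bar R}) (f_ : nat -> T -> R) (f h : T -> R) :
  (forall n, measurable_fun setT (f_ n)) ->
  mu.-integrable setT (EFin \o h) -> (forall n x, `|f_ n x| <= h x) ->
  (forall x, f_ ^~ x @ \oo --> f x) ->
  Rintegral mu setT (f_ n) @[n --> \oo] --> Rintegral mu setT f.
Proof.
move=> mf ih fh ff.
have mfl : measurable_fun setT f.
  by apply: (@measurable_fun_cvg _ _ _ setT f_) => // x _; exact: ff.
have [fi _ cv] : [/\ mu.-integrable setT (EFin \o f),
    (\int[mu]_x `|(f_ n x)%:E - (f x)%:E|)%E @[n --> \oo] --> 0%E &
    (\int[mu]_x (f_ n x)%:E)%E @[n --> \oo] --> (\int[mu]_x (f x)%:E)%E].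
  apply: (@dominated_convergence _ _ _ mu setT measurableT
    (fun n => EFin \o f_ n) (EFin \o f) (EFin \o h)) => //.
  - by move=> n; exact/measurable_EFinP.
  - exact/measurable_EFinP.
  - by apply: aeW => x _; apply: cvg_EFin; [exact: nearW|exact: ff].
  - by apply: aeW => x n _ /=; rewrite lee_fin.
rewrite /Rintegral.
apply: fine_cvg; rewrite fineK//; exact: integrable_fin_num.
Qed.

Lemma Cintegral_dominated d (T : measurableType d) (R : realType)
    (mu : {measure set T -> \bar R}) (f_ : nat -> T -> R[i]) (f : T -> R[i])
    (h : T -> R) :
  (forall n, cmeasurable (f_ n)) ->
  mu.-integrable setT (EFin \o h) -> (forall n x, normc (f_ n x) <= h x) ->
  (forall x, ccvg (f_ ^~ x) (f x)) ->
  ccvg (fun n => Cintegral mu (f_ n)) (Cintegral mu f).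
Proof.
move=> mf ih fh ff; split; apply: (Rintegral_dominated _ ih).
- by move=> n; case: (mf n).
- by move=> n x; apply: le_trans (fh n x); exact: Re_le_normc.
- by move=> x; case: (ff x).
- by move=> n; case: (mf n).
- by move=> n x; apply: le_trans (fh n x); exact: Im_le_normc.
- by move=> x; case: (ff x).
Qed.

Section transfer.
Context d d' (X : measurableType d) (Y : measurableType d') (R : realType).
Variables (nu : {measure set X -> \bar R}) (mu : {measure set Y -> \bar R}).
Variables (Psi : X -> Y) (K : R).
Hypothesis mPsi : measurable_fun setT Psi.
Hypothesis K0 : 0 < K.

(** [mu] is [K] times the image of [nu] under [Psi]. The formula is asked for
    nonnegative functions, the form in which Tonelli's theorem delivers it;
    signed and complex functions follow by splitting. *)
Definition transfers := forall f : Y -> \bar R, measurable_fun setT f ->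
  (forall y, 0 <= f y)%E ->
  (\int[mu]_y f y = K%:E * \int[nu]_x f (Psi x))%E.

Hypothesis tr : transfers.

Lemma transfer_integrable (f : Y -> R) : measurable_fun setT f ->
  mu.-integrable setT (EFin \o f) <-> nu.-integrable setT (EFin \o (f \o Psi)).
Proof.
move=> mf.
have E : (\int[mu]_y `|(f y)%:E| = K%:E * \int[nu]_x `|(f (Psi x))%:E|)%E.
  rewrite (tr (f := fun y => `|(f y)%:E|%E))//.
  by apply: measurableT_comp => //; exact/measurable_EFinP.
split=> /integrableP[_ fi]; apply/integrableP; split.
- by apply/measurable_EFinP; exact: measurableT_comp.
- move: fi => /=; rewrite E; case: (integral _ _ _) => [r|//|//].
    by move=> _; exact: ltry.
  by rewrite gt0_muley// lte_fin.
- exact/measurable_EFinP.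
- rewrite /= E lte_mul_pinfty//; first by rewrite lee_fin ltW.
Qed.

Lemma transfer_Rintegral (f : Y -> R) : mu.-integrable setT (EFin \o f) ->
  Rintegral mu setT f = K * Rintegral nu setT (f \o Psi).
Proof.
move=> fi.
have mf : measurable_fun setT f by apply/measurable_EFinP/measurable_int/fi.
have fi' := (transfer_integrable mf).1 fi.
rewrite /Rintegral -[K in RHS]/(fine K%:E) -fineM//; last first.
  exact: integrable_fin_num.
congr fine; rewrite integralE [in RHS]integralE.
rewrite muleBr//; last exact: integrable_add_def.
have mf' : measurable_fun setT (EFin \o f) by exact/measurable_EFinP.
have mp : measurable_fun setT ((EFin \o f)^\+)%E by exact: measurable_funepos.
have mn : measurable_fun setT ((EFin \o f)^\-)%E by exact: measurable_funeneg.
rewrite (tr mp (fun=> funepos_ge0 _ _)) (tr mn (fun=> funeneg_ge0 _ _)).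
congr (_ * _ - _ * _)%E; apply: eq_integral => x _.
  by rewrite !funeposE.
by rewrite !funenegE.
Qed.

Lemma transfer_Cintegrable (f : Y -> R[i]) : cmeasurable f ->
  Cintegrable mu f <-> Cintegrable nu (f \o Psi).
Proof.
move=> [mr mi]; rewrite /Cintegrable.
by split=> -[fr fi]; split; [apply/(transfer_integrable mr)|
  apply/(transfer_integrable mi)|apply/(transfer_integrable mr)|
  apply/(transfer_integrable mi)].
Qed.

Lemma transfer_Cintegral (f : Y -> R[i]) : Cintegrable mu f ->
  Cintegral mu f = K%:C * Cintegral nu (f \o Psi).
Proof.
move=> [fr fi]; apply: eq_ReIm => /=.
  by rewrite (transfer_Rintegral fr)/= mul0r subr0.
by rewrite (transfer_Rintegral fi)/= mul0r addr0.
Qed.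

End transfer.

(** * Linear changes of variables *)

Section affine_line.
Context {R : realType}.
Local Notation leb := (@lebesgue_measure R).

Lemma measurable_affine (x0 a : R) :
  measurable_fun setT (fun x : measurableTypeR R => x0 + a * x : measurableTypeR R).
Proof. by apply: measurable_funD => //; exact: measurable_funM. Qed.

(** Both sides are measures, so half-open intervals suffice. The preimage of
    such an interval is closed on the other side when [a < 0]. *)
Lemma lebesgue_measure_affine (x0 a : R) (A : set R) : a != 0 ->
  measurable A ->
  leb A = (`|a|%:E * leb ((fun x => x0 + a * x)%R @^-1` A))%E.
Proof.
move=> a0 mA.
pose phi := fun x : measurableTypeR R => x0 + a * x : measurableTypeR R.
have mphi : measurable_fun setT phi := measurable_affine x0 a.
pose k : {nonneg R} := NngNum (normr_ge0 a).
pose pm : {measure set (measurableTypeR R) -> \bar R} :=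
  measure_function_pushforward__canonical__measure_function_Measure leb mphi.
suff : leb A = mscale k pm A by [].
apply: lebesgue_measure_unique => //= _ [[u v]] _ <-.
rewrite /mscale/= -[pushforward _ _ _]/(leb (phi @^-1` `]u, v])).
have [ap|an|/eqP] := ltgtP a 0; last by rewrite (negbTE a0).
  rewrite (_ : phi @^-1` _ = `[(v - x0) / a, (u - x0) / a[%classic); last first.
    apply/seteqP; split => x /=; rewrite !in_itv/= /phi -ltrBlDl -lerBrDl;
    by rewrite ler_ndivrMr// ltr_ndivlMr// ![a * x]mulrC andbC.
  rewrite !lebesgue_measure_itv/= !lte_fin ltr_nM2r ?invr_lt0// ltrD2r.
  case: ifPn => _; last by rewrite mule0.
  rewrite -!EFinB -EFinM ltr0_norm//; congr EFin.
  by rewrite -mulrBl mulrC mulrN divfK//; ring.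
rewrite (_ : phi @^-1` _ = `](u - x0) / a, (v - x0) / a]%classic); last first.
  apply/seteqP; split => x /=; rewrite !in_itv/= /phi -ltrBlDl -lerBrDl;
  by rewrite ler_pdivlMr// ltr_pdivrMr// ![a * x]mulrC.
rewrite !lebesgue_measure_itv/= !lte_fin ltr_pM2r ?invr_gt0// ltrD2r.
case: ifPn => _; last by rewrite mule0.
rewrite -!EFinB -EFinM gtr0_norm//; congr EFin.
by rewrite -mulrBl mulrC divfK//; ring.
Qed.

Lemma ge0_integral_affine (x0 a : R) (f : R -> \bar R) : a != 0 ->
  measurable_fun setT f -> (forall x, 0 <= f x)%E ->
  (\int[leb]_x f (x0 + a * x)%R = `|a|^-1%:E * \int[leb]_x f x)%E.
Proof.
move=> a0 mf f0.
pose phi := fun x : measurableTypeR R => x0 + a * x : measurableTypeR R.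
have mphi : measurable_fun setT phi := measurable_affine x0 a.
pose k : {nonneg R} := NngNum (normr_ge0 a).
pose pm : {measure set (measurableTypeR R) -> \bar R} :=
  measure_function_pushforward__canonical__measure_function_Measure leb mphi.
have -> : (\int[leb]_x f x =
    \int[mscale k pm]_x f x)%E.
  by apply: eq_measure_integral => A mA _; exact: lebesgue_measure_affine.
rewrite ge0_integral_mscale//= ge0_integral_pushforward// muleA -EFinM.
by rewrite mulVf ?normr_eq0// mul1e.
Qed.

End affine_line.

Section tuple_integrals.
Context {R : realType}.
Local Notation leb := (@lebesgue_measure R).
Local Notation mu := (lebesgue_tuple R).
Local Notation tup m := (m.-tuple (measurableTypeR R)).
Local Open Scope ereal_scope.

Lemma measurable_cons_pair m :
  measurable_fun setT (@cons_pair _ (measurableTypeR R) m).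
Proof. exact: measurable_cons. Qed.

Lemma measurable_comp_cons d (T : measurableType d) m (f : tup m.+1 -> T) :
  measurable_fun setT f -> measurable_fun setT
    (fun p : measurableTypeR R * tup m => f (cons_pair p)).
Proof.
move=> mf; exact: (measurableT_comp
  (g := @cons_pair _ (measurableTypeR R) m) mf (@measurable_cons_pair m)).
Qed.

Lemma ge0_integral_consE m (f : tup m.+1 -> \bar R) :
  measurable_fun setT f -> (forall s, 0 <= f s) ->
  \int[mu m.+1]_s f s = \int[leb \x mu m]_p f (cons_pair p).
Proof.
move=> mf f0.
rewrite -[LHS]/(\int[pushforward (leb \x mu m)
  (@cons_pair _ (measurableTypeR R) m)]_s f s).
by rewrite ge0_integral_pushforward//; exact: measurable_cons_pair.
Qed.

Lemma ge0_integral_cons m (f : tup m.+1 -> \bar R) :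
  measurable_fun setT f -> (forall s, 0 <= f s) ->
  \int[mu m.+1]_s f s = \int[leb]_x \int[mu m]_s f (cons_pair (x, s)).
Proof.
move=> mf f0; rewrite ge0_integral_consE// fubini_tonelli1//.
exact: measurable_comp_cons.
Qed.

Lemma ge0_integral_cons_swap m (f : tup m.+1 -> \bar R) :
  measurable_fun setT f -> (forall s, 0 <= f s) ->
  \int[mu m.+1]_s f s = \int[mu m]_s \int[leb]_x f (cons_pair (x, s)).
Proof.
move=> mf f0; rewrite ge0_integral_consE// fubini_tonelli2//.
exact: measurable_comp_cons.
Qed.

Lemma measurable_tuple0 d (T : measurableType d) (f : tup 0 -> T) :
  measurable_fun setT f.
Proof.
move=> _ Y _; have [e|ne] := pselect (Y (f [tuple])).
  rewrite (_ : _ `&` _ = setT)//.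
  by apply/seteqP; split => // s _; split => //; rewrite /= (tuple0 s).
rewrite (_ : _ `&` _ = set0)//.
by apply/seteqP; split => // s [_]; rewrite /= (tuple0 s).
Qed.

Lemma ge0_integral_tuple0 (f : tup 0 -> \bar R) :
  \int[mu 0]_s f s = f [tuple].
Proof.
rewrite -[LHS]/(\int[@dirac _ (tup 0) [tuple] R]_s f s) integral_dirac//.
  by rewrite diracT mul1e.
exact: measurable_tuple0.
Qed.

Definition rowt m (s : m.-tuple R) : 'rV[R]_m := \row_j tnth s j.

Definition aff m r (A : 'M[R]_(m, r)) (x0 : 'rV[R]_r) (s : m.-tuple R) :
  r.-tuple R := [tuple (x0 + rowt s *m A)%R 0%R j | j < r].

Lemma rowt_aff m r (A : 'M[R]_(m, r)) x0 s :
  rowt (aff A x0 s) = (x0 + rowt s *m A)%R.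
Proof. by apply/rowP => j; rewrite mxE tnth_mktuple. Qed.

Lemma rowt_inj m : injective (@rowt m).
Proof.
move=> s t st; apply: eq_from_tnth => j.
by move/rowP : st => /(_ j); rewrite !mxE.
Qed.

Lemma aff_comp m r q (A : 'M[R]_(m, r)) (B : 'M[R]_(r, q)) x0 y0 s :
  aff B y0 (aff A x0 s) = aff (A *m B) (y0 + x0 *m B)%R s.
Proof. by apply: rowt_inj; rewrite !rowt_aff mulmxDl mulmxA addrA. Qed.

Lemma measurable_rowt m r (A : 'M[R]_(m, r)) (x0 : 'rV[R]_r) j :
  measurable_fun setT (fun s : tup m => (x0 + rowt s *m A)%R 0%R j).
Proof.
rewrite (_ : (fun s => _) =
    fun s : tup m => (x0 0 j + \sum_i tnth s i * A i j)%R); last first.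
  apply/funext => s; rewrite !mxE; congr +%R.
  by apply: eq_bigr => i _; rewrite mxE.
apply: measurable_funD => //.
apply: measurable_sum => i; apply: measurable_funM => //.
exact: measurable_tnth.
Qed.

Lemma measurable_aff m r (A : 'M[R]_(m, r)) (x0 : 'rV[R]_r) :
  measurable_fun setT (aff A x0 : tup m -> tup r).
Proof.
apply/measurable_fun_tnthP => j.
rewrite (_ : _ \o _ = fun s : tup m => (x0 + rowt s *m A)%R 0%R j).
  exact: measurable_rowt.
by apply/funext => s /=; rewrite tnth_mktuple.
Qed.

Lemma rowt_cons m x (s : m.-tuple R) :
  rowt (cons_pair (x, s)) = row_mx x%:M (rowt s) :> 'rV[R]_(1 + m).
Proof.
apply/rowP => j; rewrite !mxE; case: splitP => i ji.
  by rewrite (ord1 i) in ji *; rewrite (_ : j = ord0) ?mxE//; exact/val_inj.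
by rewrite mxE (_ : j = lift ord0 i) ?tnthS//; exact/val_inj.
Qed.

Lemma aff_lower m (c : 'cV[R]_m) (D : 'M[R]_m) (x0 : 'rV[R]_(1 + m)) x
    (s : m.-tuple R) :
  aff (block_mx 1%:M 0 c D) x0 (cons_pair (x, s)) =
  cons_pair ((lsubmx x0 0 0 + (rowt s *m c) 0 0 + 1 * x)%R,
             aff D (rsubmx x0) s).
Proof.
apply: rowt_inj; rewrite rowt_aff !rowt_cons rowt_aff.
rewrite mul_row_block mulmx1 mulmx0 add0r -[x0 in LHS]hsubmxK add_row_mx.
congr row_mx; apply/matrixP => i j; rewrite !ord1 !mxE/= !mulr1n mul1r.
by rewrite addrCA addrC.
Qed.

Lemma aff_upper m (a : R) (b : 'rV[R]_m) (x0 : 'rV[R]_(1 + m)) x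
    (s : m.-tuple R) :
  aff (block_mx a%:M b 0 1%:M) x0 (cons_pair (x, s)) =
  cons_pair ((lsubmx x0 0 0 + a * x)%R,
             aff 1%:M (rsubmx x0 + x *: b)%R s).
Proof.
apply: rowt_inj; rewrite rowt_aff !rowt_cons rowt_aff.
rewrite mul_row_block !mulmx1 mulmx0 addr0 -[x0 in LHS]hsubmxK add_row_mx.
congr row_mx; last by rewrite mul_scalar_mx addrA.
by rewrite -scalar_mxM [in LHS](mx11_scalar (lsubmx x0)) -raddfD mulrC.
Qed.

(** Quantifying over the translation [x0] is what makes the induction on the
    dimension work: fixing one coordinate turns a linear map of the others into
    an affine one. *)
Definition lin_change m (A : 'M[R]_m) := forall x0 (f : tup m -> \bar R),
  measurable_fun setT f -> (forall s, 0 <= f s) ->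
  \int[mu m]_s f (aff A x0 s) = `|\det A|^-1%:E * \int[mu m]_s f s.

Lemma measurable_comp_aff d (T : measurableType d) m r (A : 'M[R]_(m, r)) x0
    (f : tup r -> T) : measurable_fun setT f ->
  measurable_fun setT (fun s : tup m => f (aff A x0 s)).
Proof.
move=> mf.
exact: (measurableT_comp (g := aff A x0 : tup m -> tup r) mf
  (@measurable_aff m r A x0)).
Qed.

Lemma lin_change_mul m (A B : 'M[R]_m) :
  lin_change A -> lin_change B -> lin_change (A *m B).
Proof.
move=> lA lB x0 f mf f0.
transitivity (\int[mu m]_s f (aff B x0 (aff A 0%R s))).
  by apply: eq_integral => s _; rewrite aff_comp mul0mx addr0.
rewrite (lA 0%R (fun s => f (aff B x0 s)))//; last exact: measurable_comp_aff.
by rewrite lB// muleA -EFinM det_mulmx normrM invfM.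
Qed.

(** For a fixed tail [s], the first coordinate undergoes a translation only. *)
Lemma lin_change_lower m (c : 'cV[R]_m) (D : 'M[R]_m) :
  lin_change D -> lin_change (block_mx 1%:M 0 c D : 'M[R]_(1 + m)).
Proof.
move=> lD x0 f mf f0.
have mfa := measurable_comp_aff (block_mx 1%:M 0 c D : 'M[R]_(1 + m)) x0 mf.
rewrite (ge0_integral_cons_swap mfa)//.
have mfp := measurable_comp_cons mf.
transitivity (\int[mu m]_s \int[leb]_x
    f (cons_pair (x, aff D (rsubmx (x0 : 'rV[R]_(1 + m))) s))).
  apply: eq_integral => s _.
  under eq_integral do rewrite aff_lower.
  rewrite (ge0_integral_affine _
    (f := fun x => f (cons_pair (x, aff D (rsubmx x0) s)))) ?oner_eq0//.
    by rewrite normr1 invr1 mul1e.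
  exact: (measurable_fun_pair1 _ mfp).
rewrite (lD _ (fun s => \int[leb]_x f (cons_pair (x, s))))//.
- by rewrite -ge0_integral_cons_swap// det_lblock det1 mul1r.
- exact: (measurable_fun_fubini_tonelli_G (m1 := leb)
    (fun p : measurableTypeR R * tup m => f (cons_pair p))).
- by move=> s; exact: integral_ge0.
Qed.

(** For a fixed first coordinate, the tail undergoes a translation only. *)
Lemma lin_change_upper m (a : R) (b : 'rV[R]_m) : a != 0%R ->
  lin_change (1%:M : 'M[R]_m) ->
  lin_change (block_mx a%:M b 0 1%:M : 'M[R]_(1 + m)).
Proof.
move=> a0 l1 x0 f mf f0.
have mfa := measurable_comp_aff (block_mx a%:M b 0 1%:M : 'M[R]_(1 + m)) x0 mf.
rewrite (ge0_integral_cons mfa)//.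
have mfp := measurable_comp_cons mf.
transitivity (\int[leb]_x \int[mu m]_s
    f (cons_pair ((lsubmx (x0 : 'rV[R]_(1 + m)) 0 0 + a * x)%R, s))).
  apply: eq_integral => x _.
  under eq_integral do rewrite aff_upper.
  rewrite (l1 _ (fun s => f (cons_pair ((lsubmx x0 0 0 + a * x)%R, s))))//.
    by rewrite det1 normr1 invr1 mul1e.
  exact: (measurable_fun_pair2 _ mfp).
rewrite (ge0_integral_affine _
    (f := fun x => \int[mu m]_s f (cons_pair (x, s))))//.
- by rewrite -ge0_integral_cons// det_ublock det1 mulr1 det_scalar1.
- exact: (measurable_fun_fubini_tonelli_F (m2 := mu m)
    (fun p : measurableTypeR R * tup m => f (cons_pair p))).
- by move=> s; exact: integral_ge0.
Qed.

(** Gaussian elimination: an invertible matrix whose corner entry does not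
    vanish is the product of a lower and an upper block matrix, and an
    elementary row operation makes the corner entry nonzero. *)
Lemma lin_change_unit m (A : 'M[R]_m) : A \in unitmx -> lin_change A.
Proof.
elim: m A => [A _ x0 f mf f0|m ih].
  rewrite !ge0_integral_tuple0 det_mx00 normr1 invr1 mul1e.
  by congr f; exact: tuple0.
have l1 : lin_change (1%:M : 'M[R]_m) by apply: ih; exact: unitmx1.
(* the lower factor contains the Schur complement [D], of smaller size *)
have pivot (A : 'M[R]_(1 + m)) :
    A \in unitmx -> (ulsubmx A 0 0 != 0)%R -> lin_change A.
  move=> uA; set a := (ulsubmx A 0 0)%R => a0.
  pose c : 'cV[R]_m := (a^-1 *: dlsubmx A)%R.
  pose D : 'M[R]_m := (drsubmx A - c *m ursubmx A)%R.
  have AE : A = block_mx 1%:M 0 c D *m block_mx a%:M (ursubmx A) 0 1%:M.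
    rewrite mulmx_block !mul1mx !mul0mx !mulmx0 !mulmx1 !addr0.
    rewrite -[LHS]submxK; congr block_mx.
    - exact: mx11_scalar.
    - by rewrite mul_mx_scalar /c scalerA mulfV// scale1r.
    - by rewrite /D addrC subrK.
  have uD : D \in unitmx.
    move: uA; rewrite AE !unitmxE det_mulmx det_lblock det_ublock !det1.
    by rewrite mul1r mulr1 unitrM => /andP[].
  by rewrite AE; apply: lin_change_mul;
    [exact/lin_change_lower/ih|exact: lin_change_upper].
move=> A; rewrite -[m.+1]/(1 + m)%N in A *; move=> uA.
have [a0|a0] := eqVneq (ulsubmx A 0 0 : R)%R 0%R; last exact: pivot.
have [j cj] : exists j : 'I_m, (dlsubmx A j 0 != 0)%R.
  apply/existsP; apply: contraT; rewrite negb_exists => /forallP c0.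
  move: uA; rewrite unitmxE (_ : \det A = 0%R) ?unitr0//.
  rewrite -[A]submxK (_ : dlsubmx A = 0%R) ?det_ublock; last first.
    by apply/colP => i; rewrite [RHS]mxE; apply/eqP; have := c0 i; rewrite negbK.
  by rewrite [ulsubmx A]mx11_scalar a0 det_scalar1 mul0r.
pose E (e : R) : 'M[R]_(1 + m) := block_mx 1%:M (e *: delta_mx 0 j)%R 0%R 1%:M.
have lE e : lin_change (E e).
  by apply: lin_change_upper => //; rewrite oner_eq0.
have uE e : E e \in unitmx by rewrite unitmxE det_ublock !det1 mulr1 unitr1.
rewrite (_ : A = E (-1)%R *m (E 1%R *m A)).
  apply: lin_change_mul => //; apply: pivot; first by rewrite unitmx_mul uE.
  rewrite -[X in _ *m X]submxK mulmx_block block_mxKul mul1mx scale1r.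
  rewrite -rowE mxE a0 add0r.
  by rewrite !mxE in cj *.
rewrite mulmxA mulmx_block !mul1mx !mulmx1 !mulmx0 !mul0mx !addr0 add0r.
by rewrite scale1r scaleN1r subrr -scalar_mx_block mul1mx.
Qed.

End tuple_integrals.

(** * Slice coordinates and integrals of products *)

Section tuple_transfer.
Context {R : realType}.
Local Notation leb := (@lebesgue_measure R).
Local Notation mu := (lebesgue_tuple R).
Local Notation tup m := (m.-tuple (measurableTypeR R)).
Local Open Scope ereal_scope.

Lemma measurable_cat n k :
  measurable_fun setT (fun p : tup n * tup k => cat_tuple p.1 p.2 : tup (n + k)).
Proof.
apply/measurable_fun_tnthP => j.
have [i|i] := split_ordP j => [->|->].
  rewrite (_ : _ \o _ = fun p : tup n * tup k => tnth p.1 i).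
    exact: measurableT_comp (measurable_tnth i) measurable_fst.
  by apply/funext => p /=; rewrite tnth_lshift.
rewrite (_ : _ \o _ = fun p : tup n * tup k => tnth p.2 i).
  exact: measurableT_comp (measurable_tnth i) measurable_snd.
by apply/funext => p /=; rewrite tnth_rshift.
Qed.

Lemma measurable_comp_cat d (T : measurableType d) n k (f : tup (n + k) -> T) :
  measurable_fun setT f -> measurable_fun setT
    (fun p : tup n * tup k => f (cat_tuple p.1 p.2)).
Proof. by move=> mf; exact: measurableT_comp mf (@measurable_cat n k). Qed.

Lemma ge0_integral_cat n k (f : tup (n + k) -> \bar R) :
  measurable_fun setT f -> (forall s, 0 <= f s) ->
  \int[mu (n + k)]_s f s = \int[mu n]_y \int[mu k]_h f (cat_tuple y h).
Proof.
elim: n f => [f mf f0|n ih f mf f0].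
  rewrite ge0_integral_tuple0; apply: eq_integral => h _.
  by congr f; exact/val_inj.
rewrite [LHS](ge0_integral_cons (f := f : tup (n + k).+1 -> _))//.
have mfp : measurable_fun setT (fun p : tup n.+1 * tup k => f (cat_tuple p.1 p.2)).
  exact: measurable_comp_cat.
rewrite (ge0_integral_cons (f := fun y => \int[mu k]_h f (cat_tuple y h))); last 2 first.
- exact: (measurable_fun_fubini_tonelli_F (m2 := mu k)
    (fun p : tup n.+1 * tup k => f (cat_tuple p.1 p.2))).
- by move=> s; exact: integral_ge0.
apply: eq_integral => x _.
rewrite (ih (fun s => f (cons_pair (x, s))))//; last first.
  exact: (measurable_fun_pair2 _ (measurable_comp_cons mf)).
apply: eq_integral => y _; apply: eq_integral => h _.
by congr f; exact/val_inj.
Qed.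

(** Coordinates adapted to a linear map [L] with [V L = 0] and [W L = 1]: [y]
    moves along its fibres and [h] across them. *)
Definition slice n k (V : 'M[R]_(n, n + k)) (W : 'M[R]_(k, n + k))
    (x0 : 'rV[R]_(n + k)) (p : n.-tuple R * k.-tuple R) : (n + k).-tuple R :=
  aff (col_mx V W) x0 (cat_tuple p.1 p.2).

Lemma rowt_cat n k (y : n.-tuple R) (h : k.-tuple R) :
  rowt (cat_tuple y h) = row_mx (rowt y) (rowt h).
Proof.
apply/rowP => j; rewrite !mxE; case: splitP => i ji; rewrite !mxE.
  by rewrite (_ : j = lshift k i) ?tnth_lshift//; exact/val_inj.
by rewrite (_ : j = rshift n i) ?tnth_rshift//; exact/val_inj.
Qed.

Lemma rowt_slice n k V W x0 (p : n.-tuple R * k.-tuple R) :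
  rowt (slice V W x0 p) = (x0 + (rowt p.1 *m V + rowt p.2 *m W))%R.
Proof. by rewrite rowt_aff rowt_cat mul_row_col. Qed.

Lemma measurable_slice n k V W x0 :
  measurable_fun setT (slice V W x0 : tup n * tup k -> tup (n + k)).
Proof.
exact: (measurable_comp_cat (measurable_aff (col_mx V W) x0)).
Qed.

Lemma transfer_slice n k (V : 'M[R]_(n, n + k)) (W : 'M[R]_(k, n + k)) x0 :
  col_mx V W \in unitmx ->
  transfers (mu n \x mu k) (mu (n + k)) (slice V W x0) `|\det (col_mx V W)|.
Proof.
move=> uM f mf f0.
have d0 : `|\det (col_mx V W)|%R != 0%R.
  by rewrite normr_eq0 -unitfE -unitmxE.
have := lin_change_unit uM x0 mf f0.
rewrite ge0_integral_cat//; last exact: measurable_comp_aff.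
rewrite -(fubini_tonelli1 (m1 := mu n) (m2 := mu k) (fun p => f (slice V W x0 p)))//.
  by move=> ->; rewrite muleA -EFinM mulfV// mul1e.
exact: measurableT_comp mf (measurable_slice V W x0).
Qed.

Lemma transfer_cons m :
  transfers (leb \x mu m) (mu m.+1) (@cons_pair _ (measurableTypeR R) m) 1.
Proof. by move=> f mf f0; rewrite mul1e; exact: ge0_integral_consE. Qed.

Lemma transfer_aff m (A : 'M[R]_m) x0 : A \in unitmx ->
  transfers (mu m) (mu m) (aff A x0) `|\det A|.
Proof.
move=> uA f mf f0; rewrite (lin_change_unit uA)// muleA -EFinM mulfV ?mul1e//.
by rewrite normr_eq0 -unitfE -unitmxE.
Qed.

Lemma ge0_integral_prod m (F : 'I_m -> R -> R) :
  (forall i, measurable_fun setT (F i)) -> (forall i x, 0 <= F i x)%R ->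
  \int[mu m]_s (\prod_i F i (tnth s i))%:E = \prod_i \int[leb]_x (F i x)%:E.
Proof.
elim: m F => [F _ _|m ih F mF F0].
  by rewrite ge0_integral_tuple0 !big_ord0.
have mprod r (G : 'I_r -> R -> R) : (forall i, measurable_fun setT (G i)) ->
    measurable_fun setT (fun s : tup r => \prod_i G i (tnth s i))%R.
  move=> mG; apply: measurable_prod => i _.
  exact: measurableT_comp (mG i) (measurable_tnth i).
have G0 (s : m.-tuple R) : (0 <= \prod_i F (lift ord0 i) (tnth s i))%R.
  by apply: prodr_ge0.
rewrite ge0_integral_cons; last 2 first.
- by apply/measurable_EFinP; exact: mprod.
- by move=> s; rewrite lee_fin; apply: prodr_ge0.
transitivity (\int[leb]_x ((F ord0 x)%:E *
    \prod_(i < m) \int[leb]_y (F (lift ord0 i) y)%:E)).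
  apply: eq_integral => x _; rewrite -ih// -ge0_integralZl//.
  - apply: eq_integral => s _; rewrite big_ord_recl EFinM; congr (_ * _%:E).
    by apply: eq_bigr => i _; rewrite tnthS.
  - by apply/measurable_EFinP; exact: (mprod _ (fun i => F (lift ord0 i))).
  - by move=> s _; rewrite lee_fin; exact: G0.
  - by rewrite lee_fin.
rewrite ge0_integralZr//.
- by rewrite big_ord_recl.
- by apply/measurable_EFinP; exact: mF.
- by move=> x _; rewrite lee_fin.
- by apply: prode_ge0 => i _; apply: integral_ge0 => x _; rewrite lee_fin.
Qed.

End tuple_transfer.

Lemma Cintegral_prod (R : realType) m (f : 'I_m -> R -> R[i]) :
  (forall i, Cintegrable (@lebesgue_measure R) (f i)) ->
  Cintegrable (lebesgue_tuple R m) (fun s => \prod_i f i (tnth s i)) /\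
  Cintegral (lebesgue_tuple R m) (fun s => \prod_i f i (tnth s i)) =
  \prod_i Cintegral (@lebesgue_measure R) (f i).
Proof.
have mprod r (G : 'I_r -> R -> R[i]) :
    (forall i, Cintegrable (@lebesgue_measure R) (G i)) ->
    cmeasurable (fun s : r.-tuple (measurableTypeR R) => \prod_i G i (tnth s i)).
  move=> iG; apply: cmeasurable_prod => i.
  have [mr mi] := Cintegrable_measurable (iG i).
  by split; [exact: measurableT_comp mr (measurable_tnth i)|
             exact: measurableT_comp mi (measurable_tnth i)].
elim: m f => [|m ih] f fi.
  have i0 (g : 0.-tuple (measurableTypeR R) -> R) :
      (lebesgue_tuple R 0).-integrable setT (EFin \o g).
    apply/integrableP; split; first exact: measurable_tuple0.
    by rewrite ge0_integral_tuple0 /= ltry.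
  split; first by split; exact: i0.
  by rewrite big_ord0 /Cintegral /Rintegral !ge0_integral_tuple0 !big_ord0.
have [gi gE] := ih _ (fun i => fi (lift ord0 i)).
pose g (s : m.-tuple (measurableTypeR R)) :=
  \prod_i f (lift ord0 i) (tnth s i).
pose F (p : measurableTypeR R * m.-tuple (measurableTypeR R)) :=
  f ord0 p.1 * g p.2.
have FE : F = (fun s : m.+1.-tuple (measurableTypeR R) =>
    \prod_i f i (tnth s i)) \o @cons_pair _ (measurableTypeR R) m.
  apply/funext => -[x s] /=; rewrite big_ord_recl /F /g; congr (_ * _).
  by apply: eq_bigr => i _; rewrite tnthS.
have mcons := @measurable_cons_pair R m.
have tr := @transfer_cons R m.
have Fi : Cintegrable (@lebesgue_measure R \x lebesgue_tuple R m)%E F.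
  have im := integrable_mul_prod (Cintegrable_normc (fi ord0))
    (Cintegrable_normc gi).
  apply: (Cintegrable_le _ im).
  - rewrite FE; have [mr mi] := mprod _ f fi.
    by split; [exact: measurable_comp_cons mr|exact: measurable_comp_cons mi].
  - by move=> p; rewrite ComplexField.Normc.normcM.
have fint : Cintegrable (lebesgue_tuple R m.+1)
    (fun s => \prod_i f i (tnth s i)).
  by apply/(transfer_Cintegrable mcons ltr01 tr) => //;
    [exact: mprod|rewrite -FE].
split=> //; rewrite (transfer_Cintegral mcons ltr01 tr fint) mul1r -FE.
have [_ <-] := Cintegral_fubini1 Fi (fun x => CintegrableZ (f ord0 x) gi).
under eq_Cintegral => x do rewrite /F/= (CintegralZ _ gi) mulrC.
by rewrite (CintegralZ _ (fi ord0)) big_ord_recl mulrC gE.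
Qed.

(** * The fundamental theorem of calculus on the line *)

Section line.
Context {R : realType}.
Local Notation leb := (@lebesgue_measure R).
Implicit Types (f F g : R -> R).

Lemma is_derive_continuous f (df : R -> R) :
  (forall x : R, is_derive x (1:R) f (df x)) -> continuous f.
Proof.
move=> dfx x; apply: differentiable_continuous; apply/derivable1_diffP.
by have := dfx x => /@ex_derive.
Qed.

(** The integrands below oscillate, so the integrals over [[0, n]] are compared
    with the integral over the half line by dominated convergence. *)
Lemma Rintegral_FTC2y f F (l : R) : continuous f ->
  leb.-integrable `[0, +oo[ (EFin \o f) ->
  (forall x : R, is_derive x (1:R) F (f x)) -> F x @[x --> +oo] --> l ->
  Rintegral leb `[0, +oo[ f = l - F 0.
Proof.
move=> cf fi dF Fl.
have cF : continuous F := is_derive_continuous dF.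
have fiT : leb.-integrable setT (EFin \o (f \_ `[0, +oo[)).
  by rewrite -restrict_EFin; apply/integrable_restrict => //; rewrite setTI.
have mf : measurable_fun setT f by exact: continuous_measurable_fun.
pose f_ n := f \_ `[0, n.+1%:R].
have cv : Rintegral leb setT (f_ n) @[n --> \oo] -->
    Rintegral leb setT (f \_ `[0, +oo[).
  apply: (@Rintegral_dominated _ (measurableTypeR R) R leb f_ _
    (fun x => `|(f \_ `[0, +oo[) x|)).
  - move=> n; apply/(measurable_restrictT _ _).1 => //.
    exact: measurable_funTS.
  - exact: integrable_norm.
  - move=> n x /=; rewrite /f_ !patchE; case: ifPn => [|_]; last first.
      by rewrite normr0.
    by rewrite inE/= in_itv/= => /andP[x0 _]; rewrite mem_set//= in_itv/= x0.
  - move=> x; apply: cvg_near_cst; near=> n; rewrite /f_ !patchE.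
    have xn : x <= n.+1%:R.
      apply: (@le_trans _ _ n%:R); last by rewrite ler_nat.
      by near: n; exact: nbhs_infty_ger.
    congr (if _ then _ else _); apply/idP/idP; rewrite !inE/= !in_itv/=.
      by move=> /andP[->].
    by rewrite andbT => ->.
have E n : Rintegral leb setT (f_ n) = F n.+1%:R - F 0.
  rewrite /f_ -Rintegral_mkcond /Rintegral (@continuous_FTC2 _ f F)//.
  - exact: continuous_subspaceT.
  - split; last 2 first.
    + exact/cvg_at_right_filter/cF.
    + exact/cvg_at_left_filter/cF.
    + by move=> x _; have := dF x => /@ex_derive.
  - by move=> x _; rewrite derive1E; have := dF x => /@derive_val.
rewrite Rintegral_mkcond.
suff cv2 : Rintegral leb setT (f_ n) @[n --> \oo] --> l - F 0.
  exact: (cvg_unique _ cv cv2).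
under eq_fun do rewrite E.
apply: cvgB; last exact: cvg_cst.
apply: (cvg_comp (fun n : nat => n.+1%:R : R) F _ Fl).
have := @cvgr_idn R; rewrite -cvg_shiftS; exact.
Unshelve. all: by end_near. Qed.

Lemma integrable_opp f : leb.-integrable setT (EFin \o f) ->
  leb.-integrable setT (EFin \o (f \o -%R)) /\
  Rintegral leb setT f = Rintegral leb setT (f \o -%R).
Proof.
move=> fi.
have mf : measurable_fun setT f.
  by apply/measurable_EFinP; exact: (measurable_int leb fi).
have mN : measurable_fun setT (-%R : measurableTypeR R -> measurableTypeR R).
  exact: oppr_measurable.
have tr : transfers leb leb (-%R : measurableTypeR R -> measurableTypeR R) 1.
  move=> g mg g0.
  have := @ge0_integral_affine R 0 (-1) g; rewrite oppr_eq0 oner_eq0.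
  move=> /(_ isT mg g0); rewrite normrN normr1 invr1 mul1e => <-.
  by rewrite mul1e; apply: eq_integral => x _; rewrite add0r mulN1r.
split; first exact: (transfer_integrable mN ltr01 tr mf).1 fi.
by rewrite (transfer_Rintegral mN ltr01 tr fi) mul1r.
Qed.

(** Folding the line onto a half line removes the corner of [exp (- e |v|)] at
    the origin. *)
Lemma Rintegral_sym f : leb.-integrable setT (EFin \o f) ->
  leb.-integrable `[0, +oo[ (EFin \o (fun x => f x + f (- x))) /\
  Rintegral leb setT f = Rintegral leb `[0, +oo[ (fun x => f x + f (- x)).
Proof.
move=> fi.
have [fNi _] := integrable_opp fi.
have restr (g : R -> R) (D : set R) : measurable D ->
    leb.-integrable setT (EFin \o g) -> leb.-integrable D (EFin \o g).
  by move=> mD; apply: integrableS.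
split.
  by apply: (integrableD _ (restr _ _ _ fi) (restr _ _ _ fNi)).
rewrite RintegralD//; [|exact: (restr _ _ _ fi)|exact: (restr _ _ _ fNi)].
have mf : measurable_fun setT f.
  by apply/measurable_EFinP; exact: (measurable_int leb fi).
have neg : Rintegral leb `]-oo, 0[ f = Rintegral leb `[0, +oo[ (f \o -%R).
  rewrite Rintegral_itv_bndo_bndc; last exact: restr.
  rewrite Rintegral_mkcond.
  have fri : leb.-integrable setT (EFin \o (f \_ `]-oo, 0])).
    rewrite -restrict_EFin; apply/integrable_restrict => //; rewrite setTI.
    exact: restr.
  have [_ ->] := integrable_opp fri.
  rewrite [RHS]Rintegral_mkcond; apply: eq_Rintegral => x _ /=.
  rewrite !patchE; congr (if _ then _ else _).
  by apply/idP/idP; rewrite !inE/= !in_itv/= oppr_le0 ?andbT.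
have TE : [set: R] = `]-oo, 0[%classic `|` `[0, +oo[%classic.
  apply/seteqP; split => // x _ /=; rewrite !in_itv/= andbT.
  by case: (ltP x 0); [left|right].
rewrite [in LHS]TE Rintegral_setU//=; last 2 first.
- by rewrite -TE.
- rewrite disj_set2E; apply/eqP/seteqP; split => // x /=; rewrite !in_itv/=.
  by rewrite andbT => -[x0 /le_lt_trans/(_ x0)]; rewrite ltxx.
by rewrite neg addrC.
Qed.

Lemma Rintegral_FTC2T f F (l l' : R) : continuous f ->
  leb.-integrable setT (EFin \o f) ->
  (forall x : R, is_derive x (1:R) F (f x)) ->
  F x @[x --> +oo] --> l -> F x @[x --> -oo] --> l' ->
  Rintegral leb setT f = l - l'.
Proof.
move=> cf fi dF Fl Fl'.
have [si ->] := Rintegral_sym fi.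
pose S x := F x - F (- x).
have -> : l - l' = (l - l') - S 0 by rewrite /S oppr0 subrr subr0.
apply: (@Rintegral_FTC2y _ S) => //.
- move=> x; apply: cvgD; first exact: cf.
  by apply: (@continuous_comp _ _ _ -%R f); [exact: opp_continuous|exact: cf].
- move=> x; rewrite /S.
  have dFN : is_derive x 1 (fun x => F (- x)) (- f (- x)).
    have := is_derive1_comp (f := F) (g := -%R) (x := x) _ _.
    by move=> /(_ _ _ (dF (- x)) _) H; apply: is_derive_eq; rewrite mulrN1.
  by have := dF x; move=> ?; apply: is_derive_eq; rewrite opprK.
- apply: cvgB => //; exact/cvgNy_compNP.
Qed.

End line.

(** * The Poisson kernel *)

Section poisson_kernel.
Context {R : realType}.
Local Notation leb := (@lebesgue_measure R).

Definition expN (d s : R) : R := expR (- (d * `|s|)).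

Lemma cvg_expN (d : R) : 0 < d -> expR (- (d * x)) @[x --> +oo] --> 0.
Proof.
move=> d0; apply: (cvg_comp (fun x => d * x) (fun x => expR (- x)) _ (@cvgr_expR R)).
by apply: gt0_cvgMry => //; exact: cvg_id.
Qed.

Lemma expN_cvgy (d : R) : 0 < d -> expN d x @[x --> +oo] --> 0.
Proof.
move=> d0; apply: cvg_trans (cvg_expN d0); apply: near_eq_cvg; near=> x.
have x0 : 0 <= x by near: x; apply: nbhs_pinfty_ge; exact: num_real.
by rewrite /expN ger0_norm.
Unshelve. all: by end_near. Qed.

Lemma expN_cvgNy (d : R) : 0 < d -> expN d x @[x --> -oo] --> 0.
Proof.
move=> d0; apply/cvgNy_compNP; apply: cvg_trans (expN_cvgy d0).
by apply: near_eq_cvg; near=> x; rewrite /expN /= normrN.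
Unshelve. all: by end_near. Qed.

Lemma cvg0_le_expN (f : R -> R) (d C : R) : 0 < d ->
  (forall x, `|f x| <= C * expN d x) ->
  f x @[x --> +oo] --> 0 /\ f x @[x --> -oo] --> 0.
Proof.
move=> d0 fC.
suff H (F : set_system R) : Filter F ->
    expN d x @[x --> F] --> 0 -> f x @[x --> F] --> 0.
  by split; apply: H; [exact: expN_cvgy|exact: expN_cvgNy].
move=> FF e0; apply: norm_cvg0; apply: (@squeeze_cvgr _ _ _ _ (cst 0)
  (fun x => C * expN d x)).
- by near=> x; rewrite normr_ge0 fC.
- exact: cvg_cst.
- by rewrite -[X in _ --> X](mulr0 C); apply: cvgM => //; exact: cvg_cst.
Unshelve. all: by end_near. Qed.

Lemma continuous_expN (d : R) : continuous (expN d).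
Proof.
move=> x; rewrite /expN.
apply: (@continuous_comp _ _ _ (fun x : R => - (d * `|x|)) expR).
  apply: cvgN; apply: cvgM; first exact: cvg_cst.
  exact: norm_continuous.
exact: continuous_expR.
Qed.

Lemma integral_expN (d : R) : 0 < d ->
  (\int[leb]_s (expN d s)%:E = (2 / d)%:E)%E.
Proof.
move=> d0; rewrite ge0_symfun_integralT.
- have -> : (\int[leb]_(x in [set x | (0 <= x)%R]) (expN d x)%:E =
      \int[leb]_(x in `[0%R, +oo[) (expR (- (d * x)))%:E)%E.
    rewrite -set_itvcy; apply: eq_integral => x.
    by rewrite inE/= in_itv/= andbT => x0; rewrite /expN ger0_norm.
  rewrite (@ge0_continuous_FTC2y R _ (fun x => - d^-1 * expR (- (d * x))) 0 0).
  + by rewrite mulr0 oppr0 expR0 mulr1 sub0e -EFinN opprK -EFinM mulrC mulrC.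
  + by move=> x _; exact: expR_ge0.
  + apply: continuous_subspaceT => x.
    apply: (@continuous_comp _ _ _ (fun x : R => - (d * x)) expR).
      by apply: cvgN; apply: cvgM; [exact: cvg_cst|exact: cvg_id].
    exact: continuous_expR.
  + rewrite -[X in _ --> X](mulr0 (- d^-1)); apply: cvgM; first exact: cvg_cst.
    exact: cvg_expN.
  + by move=> x _; apply: ex_derive.
  + apply: cvg_at_right_filter; apply: cvgM; first exact: cvg_cst.
    apply: (@continuous_comp _ _ _ (fun x : R => - (d * x)) expR).
      by apply: cvgN; apply: cvgM; [exact: cvg_cst|exact: cvg_id].
    exact: continuous_expR.
  + move=> x _; rewrite derive1E.
    apply: derive_val.
    apply: is_derive_eq.
    rewrite /GRing.scale/=.
    by field; rewrite gt_eqF.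
- by move=> x; exact: expR_ge0.
- exact: continuous_expN.
- by move=> x /=; rewrite /expN normrN.
Qed.

Lemma integrable_expN (d : R) : 0 < d ->
  leb.-integrable setT (EFin \o expN d).
Proof.
move=> d0; apply/integrableP; split.
  apply/measurable_EFinP.
  exact: (continuous_measurable_fun (@continuous_expN d)).
under eq_integral do rewrite /= ger0_norm ?expR_ge0//.
by rewrite integral_expN// ltry.
Qed.

(** The Poisson kernel, up to a factor [2 pi]: the Fourier transform of
    [expN e]. *)
Definition poisson (e x : R) : R := 2 * e / (e ^+ 2 + x ^+ 2).

Lemma Cintegral_laplace (e x : R) : 0 < e ->
  Cintegrable leb (fun v => (expN e v)%:C * cexp (0 +i* (x * v))) /\
  Cintegral leb (fun v => (expN e v)%:C * cexp (0 +i* (x * v))) =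
  (poisson e x)%:C.
Proof.
move=> e0.
have d0 : e ^+ 2 + x ^+ 2 != 0.
  by rewrite gt_eqF// ltr_wpDr ?sqr_ge0// exprn_gt0.
set f := fun v : R => _.
have mlin : measurable_fun setT (fun v : R => x * v) by exact: measurable_funM.
have fi : Cintegrable leb f.
  apply: (Cintegrable_le _ (integrable_expN e0)).
    apply: cmeasurable_mul.
      apply: cmeasurable_real; apply: continuous_measurable_fun.
      exact: continuous_expN.
    by apply: cmeasurable_cexp; split => //; exact: measurable_cst.
  move=> v; rewrite ComplexField.Normc.normcM normc_real ger0_norm ?expR_ge0//.
  rewrite /= expR0 !mul1r cos2Dsin2 sqrtr1 mulr1.
  exact: lexx.
split=> //; have [fr fm] := fi; apply: eq_ReIm => /=; last first.
  have [_ ->] := Rintegral_sym fm.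
  transitivity (Rintegral leb `[0, +oo[ (cst 0)).
    2: by rewrite Rintegral_cst// mul0r.
  apply: eq_Rintegral => v _ /=; rewrite !(mul0r, addr0, expR0, mul1r).
  rewrite /expN normrN mulrN sinN.
  by rewrite mulrN subrr.
have [fs ->] := Rintegral_sym fr.
pose g v := 2 * (expR (- (e * v)) * cos (x * v)).
(* an antiderivative of [g] that vanishes at infinity *)
pose H v := 2 * (expR (- (e * v)) * (x * sin (x * v) - e * cos (x * v))) /
  (e ^+ 2 + x ^+ 2).
have gE : {in `[0, +oo[%classic, (fun v => cRe (f v) + cRe (f (- v))) =1 g}.
  move=> v; rewrite inE/= in_itv/= andbT => v0.
  rewrite /f /g /= !(mul0r, subr0, expR0, mul1r) /expN normrN mulrN cosN.
  by rewrite ger0_norm// mulr2n mulrDl mul1r.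
have gi : leb.-integrable `[0, +oo[ (EFin \o g).
  by apply: eq_integrable fs => // v v0; rewrite /= gE.
transitivity (Rintegral leb `[0, +oo[ g); first exact: eq_Rintegral.
have -> : Rintegral leb `[0, +oo[ g = 0 - H 0.
  apply: Rintegral_FTC2y => //.
  - move=> v; rewrite /g; apply: cvgM; first exact: cvg_cst.
    apply: cvgM.
      apply: (@continuous_comp _ _ _ (fun x : R => - (e * x)) expR).
        by apply: cvgN; apply: cvgM; [exact: cvg_cst|exact: cvg_id].
      exact: continuous_expR.
    apply: (@continuous_comp _ _ _ (fun v : R => x * v) (@cos R)).
      by apply: cvgM; [exact: cvg_cst|exact: cvg_id].
    exact: continuous_cos.
  - move=> v; rewrite /H /g.
    apply: is_derive_eq; rewrite /GRing.scale/=.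
    by field.
  - apply: norm_cvg0.
    apply: (@squeeze_cvgr _ _ _ _ (cst 0) (fun v =>
      2 * (`|x| + e) / (e ^+ 2 + x ^+ 2) * expR (- (e * v)))).
    + near=> v; rewrite normr_ge0 /= /H.
      rewrite !normrM normfV (ger0_norm (expR_ge0 _)) [`|2|]ger0_norm//.
      rewrite [`|e ^+ 2 + x ^+ 2|]ger0_norm ?addr_ge0 ?sqr_ge0//.
      rewrite [leRHS](_ : _ =
        2 * (expR (- (e * v)) * (`|x| + e)) / (e ^+ 2 + x ^+ 2)); last by field.
      rewrite ler_pM2r ?invr_gt0 ?lt_def ?d0 ?addr_ge0 ?sqr_ge0//.
      rewrite ler_pM2l// ler_pM2l ?expR_gt0//.
      rewrite (le_trans (ler_normB _ _))// !normrM (gtr0_norm e0).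
      by rewrite lerD// ler_piMr ?sin_max ?cos_max// ltW.
    + exact: cvg_cst.
    + rewrite -[X in _ --> X](mulr0 (2 * (`|x| + e) / (e ^+ 2 + x ^+ 2))).
      by apply: cvgM; [exact: cvg_cst|exact: cvg_expN].
rewrite /H /poisson !mulr0 oppr0 expR0 sin0 cos0 mulr0 mulr1 mul1r !sub0r.
by rewrite mulrN mulNr opprK.
Unshelve. all: by end_near. Qed.

Lemma poisson_ge0 (e x : R) : 0 < e -> 0 <= poisson e x.
Proof.
by move=> e0; rewrite /poisson divr_ge0 ?mulr_ge0 ?addr_ge0 ?sqr_ge0// ltW.
Qed.

(** The kernels are dilations of a single one, hence an approximate identity
    as [e] tends to [0]. *)
Lemma poisson_scale (e x : R) : 0 < e -> e * poisson e (e * x) = poisson 1 x.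
Proof.
move=> e0; rewrite /poisson.
have x0 : 1 + x ^+ 2 != 0 by rewrite gt_eqF// ltr_wpDr ?sqr_ge0.
have x1 : 1 ^+ 2 + x ^+ 2 != 0 by rewrite expr1n.
have -> : e ^+ 2 + (e * x) ^+ 2 = e ^+ 2 * (1 + x ^+ 2) by ring.
by field; rewrite x0 gt_eqF// expr1n.
Qed.

Lemma continuous_poisson (e : R) : 0 < e -> continuous (poisson e).
Proof.
move=> e0 x; apply: cvgM; first exact: cvg_cst.
apply: cvgV; first by rewrite gt_eqF// ltr_wpDr ?sqr_ge0// exprn_gt0.
by apply: cvgD; [exact: cvg_cst|exact: exprn_continuous].
Qed.

Lemma integral_poisson1 : (\int[leb]_x (poisson 1 x)%:E = (2 * pi)%:E)%E.
Proof.
rewrite ge0_symfun_integralT.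
- have -> : (\int[leb]_(x in [set x | (0 <= x)%R]) (poisson 1 x)%:E =
      \int[leb]_(x in `[0%R, +oo[) (2%:E * (oneDsqr x)^-1%:E))%E.
    rewrite -set_itvcy; apply: eq_integral => x _.
    by rewrite /poisson expr1n mulr1 EFinM.
  rewrite ge0_integralZl//.
  + by rewrite integral0y_oneDsqr -!EFinM; congr EFin; field.
  + apply/measurable_EFinP/measurable_funTS.
    by apply: continuous_measurable_fun; exact: continuous_oneDsqrV.
- by move=> x; exact: poisson_ge0.
- exact: continuous_poisson.
- by move=> x /=; rewrite /poisson sqrrN.
Qed.

Lemma integrable_poisson1 : leb.-integrable setT (EFin \o poisson 1).
Proof.
apply/integrableP; split.
  apply/measurable_EFinP.
  exact: (continuous_measurable_fun (continuous_poisson ltr01)).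
under eq_integral do rewrite /= ger0_norm ?poisson_ge0//.
by rewrite integral_poisson1 ltry.
Qed.

Lemma Cintegral_poisson1 :
  Cintegrable leb (fun x => (poisson 1 x)%:C) /\
  Cintegral leb (fun x => (poisson 1 x)%:C) = (2 * pi)%:C.
Proof.
split.
  split; first exact: integrable_poisson1.
  exact: (integrable0 leb setT).
apply: eq_ReIm => /=; first by rewrite /Rintegral integral_poisson1.
by rewrite Rintegral_cst ?mul0r.
Qed.

End poisson_kernel.

(** * Rotating the contour of a Gamma integral *)

Section rotated_contour.
Context {R : realType}.
Local Notation leb := (@lebesgue_measure R).
Implicit Types (a w tau th s psi kap : R).

(** At minus infinity [exp (w s)] is the decaying factor; at plus infinity the
    double exponential wins, since [expR s >= s ^+ 2 / 4] makes the exponent a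
    quadratic polynomial, and the constant comes from completing the square. *)
Lemma le_expR_expN kap w s : 0 < kap -> 0 <= w ->
  expR (- kap * expR s + w * s) <= expR (4 * w ^+ 2 / kap) * expN w s.
Proof.
move=> k0 w0; rewrite /expN -expRD ler_expR.
have [s0|s0] := leP 0 s.
  rewrite ger0_norm//.
  have e1 : s ^+ 2 / 4 <= expR s.
    rewrite (_ : s = s / 2 + s / 2) ?expRD; last by field.
    rewrite (_ : _ / 4 = s / 2 * (s / 2)); last by field.
    have h : s / 2 <= expR (s / 2) by apply: le_trans (expR_ge1Dx _); rewrite lerDr.
    by apply: ler_pM => //; rewrite divr_ge0.
  have e2 : kap * (s ^+ 2 / 4) <= kap * expR s by rewrite ler_pM2l.
  have e3 : 0 <= kap / 4 * (s - 4 * w / kap) ^+ 2.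
    by rewrite mulr_ge0 ?sqr_ge0// divr_ge0// ltW.
  have e4 : kap / 4 * (s - 4 * w / kap) ^+ 2 =
      kap * (s ^+ 2 / 4) - 2 * (w * s) + 4 * w ^+ 2 / kap.
    by field; rewrite gt_eqF.
  rewrite e4 in e3; lra.
rewrite ltr0_norm// mulrN opprK.
have e1 : 0 <= kap * expR s by rewrite mulr_ge0 ?expR_ge0 ?ltW.
have e2 : 0 <= 4 * w ^+ 2 / kap by apply: divr_ge0 (ltW k0); rewrite mulr_ge0 ?sqr_ge0.
by rewrite mulNr; lra.
Qed.

(** [rotA] and [rotB] are the real and imaginary parts of
    [- a exp (s + i th) + (w + i tau) (s + i th)]. *)
Definition rotA a w tau th s : R := - (a * cos th) * expR s + w * s - tau * th.
Definition rotB a w tau th s : R := - (a * sin th) * expR s + w * th + tau * s.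

(** The phase [psi] treats the real part ([psi = 0]) and the imaginary part
    ([psi = - pi / 2]) of the exponential at the same time. *)
Definition rotK a w tau psi th s : R :=
  expR (rotA a w tau th s) * cos (rotB a w tau th s + psi).

(** The derivative of [rotK] in the angle. The Cauchy-Riemann equations say that
    it is also the derivative along the line of [rotK] with the phase advanced
    by a quarter turn. *)
Definition rotD a w tau psi th s : R :=
  expR (rotA a w tau th s) *
  ((a * sin th * expR s - tau) * cos (rotB a w tau th s + psi) -
   (- (a * cos th) * expR s + w) * sin (rotB a w tau th s + psi)).

Lemma is_derive_rotK_angle a w tau psi th s :
  is_derive th (1 : R) (fun th => rotK a w tau psi th s) (rotD a w tau psi th s).
Proof.
rewrite /rotK /rotD /rotA /rotB.
apply: is_derive_eq; rewrite /GRing.scale/=.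
by ring.
Qed.

Lemma is_derive_rotK_line a w tau psi th s :
  is_derive s (1 : R) (rotK a w tau (psi + pi / 2) th) (rotD a w tau psi th s).
Proof.
rewrite /rotK /rotD /rotA /rotB.
apply: is_derive_eq; rewrite /GRing.scale/=.
by rewrite !addrA cosDpihalf sinDpihalf; ring.
Qed.


Lemma le_expR_rotA a w tau kap M th s : 0 < a -> 0 <= w -> 0 < kap ->
  kap <= cos th -> `|th| <= M ->
  expR (rotA a w tau th s) <=
  expR (`|tau| * M) * expR (4 * w ^+ 2 / (a * kap)) * expN w s.
Proof.
move=> a0 w0 k0 kc thM.
have ak0 : 0 < a * kap by rewrite mulr_gt0.
rewrite -mulrA; apply: le_trans (ler_wpM2l (expR_ge0 _) (le_expR_expN s ak0 w0)).
rewrite -expRD ler_expR /rotA.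
have e1 : - (tau * th) <= `|tau| * M.
  rewrite -mulNr (le_trans (ler_norm _))// normrM normrN.
  by apply: ler_wpM2l.
have e2 : a * kap * expR s <= a * cos th * expR s.
  by rewrite ler_wpM2r ?expR_ge0// ler_wpM2l// ltW.
rewrite !mulNr; lra.
Qed.

Section shift.
Variables (a w tau kap : R).
Hypotheses (a0 : 0 < a) (w0 : 0 < w) (k0 : 0 < kap).

Let C M := expR (`|tau| * M) * expR (4 * w ^+ 2 / (a * kap)).
Let C1 M := expR (`|tau| * M) * expR (4 * (w + 1) ^+ 2 / (a * kap)).

Lemma rotK_le psi th M s : kap <= cos th -> `|th| <= M ->
  `|rotK a w tau psi th s| <= C M * expN w s.
Proof.
move=> kc thM; rewrite /rotK normrM ger0_norm ?expR_ge0//.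
apply: le_trans (le_expR_rotA tau s a0 (ltW w0) k0 kc thM).
by rewrite ler_piMr ?expR_ge0// cos_max.
Qed.

Lemma rotD_le psi th M s : kap <= cos th -> `|th| <= M ->
  `|rotD a w tau psi th s| <=
  (2 * a * C1 M + (`|tau| + w) * C M) * expN w s.
Proof.
move=> kc thM; rewrite /rotD normrM ger0_norm ?expR_ge0//.
set E := expR (rotA _ _ _ _ _); set B := rotB _ _ _ _ _ + psi.
have E0 : 0 <= E := expR_ge0 _.
have e0 : 0 <= expR s := expR_ge0 s.
have le1 (x y : R) : `|y| <= 1 -> `|x * y| <= `|x|.
  by move=> y1; rewrite normrM ler_piMr.
have h1 : `|(a * sin th * expR s - tau) * cos B| <= a * expR s + `|tau|.
  apply: le_trans (le1 _ _ (cos_max _)) _; apply: le_trans (ler_normB _ _) _.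
  rewrite lerD2r normrM (ger0_norm e0) ler_wpM2r// normrM gtr0_norm//.
  by rewrite ler_piMr ?sin_max// ltW.
have h2 : `|(- (a * cos th) * expR s + w) * sin B| <= a * expR s + w.
  apply: le_trans (le1 _ _ (sin_max _)) _; apply: le_trans (ler_normD _ _) _.
  rewrite (gtr0_norm w0) lerD2r normrM (ger0_norm e0) ler_wpM2r// normrN.
  by rewrite normrM gtr0_norm// ler_piMr ?cos_max// ltW.
apply: (@le_trans _ _ (E * (2 * a * expR s + (`|tau| + w)))).
  rewrite ler_wpM2l// (le_trans (ler_normB _ _))//; lra.
have a2 : 0 <= 2 * a by rewrite mulr_ge0// ltW.
have tw : 0 <= `|tau| + w by rewrite addr_ge0// ltW.
rewrite [leLHS]mulrDr [leRHS]mulrDl lerD//.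
  rewrite mulrCA -[leRHS]mulrA ler_wpM2l//.
  have -> : E * expR s = expR (rotA a (w + 1) tau th s).
    by rewrite -expRD; congr expR; rewrite /rotA; ring.
  have w1 : 0 <= w + 1 by rewrite addr_ge0// ltW.
  apply: le_trans (le_expR_rotA tau s a0 w1 k0 kc thM) _.
  rewrite ler_wpM2l ?mulr_ge0 ?expR_ge0//.
  by rewrite ler_expR lerN2 ler_wpM2r// lerDl.
rewrite mulrC -mulrA ler_wpM2l//.
exact: le_expR_rotA (ltW w0) k0 kc thM.
Qed.

Lemma continuous_rotD psi th : continuous (rotD a w tau psi th).
Proof.
rewrite /rotD /rotA /rotB.
by apply: is_derive_continuous.
Qed.

Lemma continuous_rotK psi th : continuous (rotK a w tau psi th).
Proof.
rewrite -[psi](subrK (pi / 2)).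
by apply: is_derive_continuous => s; exact: is_derive_rotK_line.
Qed.

Lemma integrable_rotK psi th : kap <= cos th ->
  leb.-integrable setT (EFin \o rotK a w tau psi th).
Proof.
move=> kc; have := integrableZl measurableT (C `|th|) (integrable_expN w0).
apply: le_integrable => //.
  apply/measurable_EFinP.
  exact: (continuous_measurable_fun (@continuous_rotK psi th)).
move=> s _ /=; rewrite lee_fin (le_trans (rotK_le _ _ kc (lexx _)))//.
by rewrite ler_norm.
Qed.

(** The integral of a derivative along the line, of a function that vanishes at
    both ends. *)
Lemma Rintegral_rotD psi th : kap <= cos th ->
  Rintegral leb setT (rotD a w tau psi th) = 0.
Proof.
move=> kc.
have iD : leb.-integrable setT (EFin \o rotD a w tau psi th).
  have := integrableZl measurableT
    (2 * a * C1 `|th| + (`|tau| + w) * C `|th|) (integrable_expN w0).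
  apply: le_integrable => //.
    apply/measurable_EFinP.
    exact: (continuous_measurable_fun (@continuous_rotD psi th)).
  move=> s _ /=; rewrite lee_fin (le_trans (rotD_le _ _ kc (lexx _)))//.
  by rewrite ler_norm.
have [cy cNy] := cvg0_le_expN w0 (fun s =>
  rotK_le (psi + pi / 2) s kc (lexx `|th|)).
rewrite -(subrr (0 : R)).
apply: (Rintegral_FTC2T (@continuous_rotD psi th) iD _ cy cNy).
by move=> s; exact: is_derive_rotK_line.
Qed.

(** Differentiation under the integral sign; the bound [rotD_le] is uniform on
    the interval of angles. *)
Lemma is_derive_rotJ psi u v th : (forall x, u < x < v -> kap <= cos x) ->
  u < th < v ->
  is_derive th (1 : R) (fun th => Rintegral leb setT (rotK a w tau psi th)) 0.
Proof.
move=> kc thuv.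
pose M := Num.max `|u| `|v|.
have xM x : u < x < v -> `|x| <= M.
  move=> /andP[ux xv].
  have uM : - u <= M by rewrite /M le_max -(normrN u) ler_norm.
  have vM : v <= M by rewrite /M le_max ler_norm orbT.
  by rewrite ler_norml; apply/andP; split; lra.
pose G s := (2 * a * C1 M + (`|tau| + w) * C M) * expN w s.
have C0 : 0 <= 2 * a * C1 M + (`|tau| + w) * C M.
  have [a1 w1] := (ltW a0, ltW w0).
  by rewrite addr_ge0// !mulr_ge0 ?expR_ge0// addr_ge0.
have d1E x s : partial1of2 (rotK a w tau psi) x s = rotD a w tau psi x s.
  by rewrite partial1of2E; have := is_derive_rotK_angle a w tau psi x s => /@derive_val.
have I x : (u < x < v) = (x \in `]u, v[%R) by rewrite in_itv.
have thI : `]u, v[%classic th by rewrite /= in_itv.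
have intK x : `]u, v[%classic x -> leb.-integrable setT (EFin \o rotK a w tau psi x).
  by rewrite /= in_itv => xuv; apply: integrable_rotK; exact: kc.
have derK x s : `]u, v[%classic x -> setT s -> derivable (rotK a w tau psi ^~ s) x 1.
  by move=> _ _; have := is_derive_rotK_angle a w tau psi x s => /@ex_derive.
have G0 s : 0 <= G s by rewrite mulr_ge0 ?expR_ge0.
have iG : leb.-integrable setT (EFin \o G).
  exact: (integrableZl measurableT _ (integrable_expN w0)).
have GK x s : `]u, v[%classic x -> setT s ->
    `|partial1of2 (rotK a w tau psi) x s| <= G s.
  by rewrite /= in_itv => xuv _; rewrite d1E; apply: rotD_le; [exact: kc|exact: xM].
apply: DeriveDef.
  exact: (derivable_under_integral measurableT thI intK derK G0 iG GK).
rewrite -derive1E.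
rewrite (differentiation_under_integral measurableT thI intK derK G0 iG GK).
under eq_Rintegral do rewrite d1E.
by rewrite Rintegral_rotD//; exact: kc.
Qed.

End shift.

(** Cauchy's theorem for the strip between two parallel lines. *)
Lemma rotJ_shift a w tau psi kap th1 th2 : 0 < a -> 0 < w -> 0 < kap ->
  th1 <= th2 -> (forall x, th1 <= x <= th2 -> kap <= cos x) ->
  Rintegral leb setT (rotK a w tau psi th1) =
  Rintegral leb setT (rotK a w tau psi th2).
Proof.
move=> a0 w0 k0 th12 kc.
(* differentiating needs an open interval of angles: the segment is enlarged a
   little, at the cost of halving the lower bound of the cosine *)
have near_cos th : kap <= cos th ->
    exists2 e, 0 < e & forall x, `|x - th| < e -> kap / 2 <= cos x.
  move=> kth; have := @continuous_cos R th.
  have k2 : 0 < kap / 2 by rewrite divr_gt0.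
  move=> /cvgrPdist_lt /(_ _ k2) /nbhs_ballP[e /= e0 be].
  exists e => // x xe; have := be x; rewrite /ball/= distrC => /(_ xe).
  by rewrite ltr_norml => /andP[_]; lra.
have [e1 e10 c1] := near_cos _ (kc th1 (introT andP (conj (lexx _) th12))).
have [e2 e20 c2] := near_cos _ (kc th2 (introT andP (conj th12 (lexx _)))).
have k2 : 0 < kap / 2 by rewrite divr_gt0.
have kc2 x : th1 - e1 < x < th2 + e2 -> kap / 2 <= cos x.
  move=> /andP[x1 x2]; have [xth1|xth1] := ltP x th1.
    by apply: c1; rewrite ltr_norml; apply/andP; split; lra.
  have [xth2|xth2] := ltP th2 x.
    by apply: c2; rewrite ltr_norml; apply/andP; split; lra.
  have := kc x; rewrite xth1 xth2 => /(_ isT); lra.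
have dJ x : th1 <= x <= th2 -> is_derive x (1 : R)
    (fun th => Rintegral leb setT (rotK a w tau psi th)) 0.
  move=> /andP[x1 x2]; apply: (@is_derive_rotJ a w tau _ a0 w0 k2 psi _ _ x kc2).
  by apply/andP; split; lra.
pose J th := Rintegral leb setT (rotK a w tau psi th).
have cJ : {within `[th1, th2], continuous J}.
  apply: derivable_within_continuous => x; rewrite in_itv/= => xI.
  by have := dJ x xI => /@ex_derive.
have [x _ JE] : exists2 x, x \in `[th1, th2]%R & J th2 - J th1 = 0 * (th2 - th1).
  apply: (MVT_segment (df := cst 0)) => // x; rewrite in_itv/= => /andP[x1 x2].
  by apply: dJ; rewrite !ltW.
by apply/eqP; rewrite eq_sym -subr_eq0 -/(J th1) -/(J th2) JE mul0r.
Qed.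

End rotated_contour.

(** * The one-variable factors and their Fourier transforms *)

Section exponential.
Context {R : realType}.
Implicit Types (x y : R[i]).

Lemma cexp0 : cexp 0 = 1 :> R[i].
Proof. by rewrite /cexp /= expR0 cos0 sin0 !mul1r. Qed.

Lemma cexpD x y : cexp (x + y) = cexp x * cexp y.
Proof.
by apply: eq_ReIm; rewrite ?Re_mul ?Im_mul /= ReD ImD expRD ?cosD ?sinD; ring.
Qed.

Lemma cexp_sum m (f : 'I_m -> R[i]) : cexp (\sum_i f i) = \prod_i cexp (f i).
Proof.
by rewrite (big_morph _ cexpD cexp0).
Qed.

Lemma normc_cexp x : normc (cexp x) = expR (cRe x).
Proof.
rewrite /cexp /= !exprMn -mulrDr cos2Dsin2 mulr1 sqrtr_sqr.
by rewrite ger0_norm// expR_ge0.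
Qed.

Lemma cexp_real (r : R) : cexp r%:C = (expR r)%:C.
Proof. by apply: eq_ReIm; rewrite /= ?cos0 ?sin0 ?mulr1 ?mulr0. Qed.

End exponential.

Section gamma_factor.
Context {R : realType}.
Local Notation leb := (@lebesgue_measure R).
Implicit Types (a w tau th s : R).

(** On an interval shorter than a quarter turn, the identity
    [cos x * sin (th2 - th1) = cos th1 * sin (th2 - x) + cos th2 * sin (x - th1)]
    and the subadditivity of the sine on such angles bound the cosine below by its values at
    the end points. *)
Lemma min_cos_le (th1 th2 x : R) : 0 < cos th1 -> 0 < cos th2 ->
  th1 <= x <= th2 -> th2 - th1 < pi / 2 ->
  Num.min (cos th1) (cos th2) <= cos x.
Proof.
move=> c1 c2 /andP[x1 x2] d.
have [D0|D0] := leP (th2 - th1) 0.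
  by rewrite (_ : x = th1) ?ge_min ?lexx//; lra.
pose m := Num.min (cos th1) (cos th2).
have m0 : 0 < m by rewrite /m lt_min c1 c2.
have [m1 m2] : m <= cos th1 /\ m <= cos th2.
  by rewrite /m !ge_min !lexx orbT.
have sin_ge0 (y : R) : 0 <= y -> y <= th2 - th1 -> 0 <= sin y.
  rewrite le_eqVlt => /predU1P[<-|y0 yD]; first by rewrite sin0.
  by apply/ltW/sin_gt0_pihalf; rewrite y0 (le_lt_trans yD).
pose al := x - th1; pose be := th2 - x.
have sal : 0 <= sin al by apply: sin_ge0; rewrite /al; lra.
have sbe : 0 <= sin be by apply: sin_ge0; rewrite /be; lra.
have sD : 0 < sin (al + be).
  apply: sin_gt0_pihalf; rewrite /al /be; apply/andP; split; lra.
have id1 : cos x * sin (al + be) = cos th1 * sin be + cos th2 * sin al.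
  rewrite (_ : th1 = x - al); last by rewrite /al; ring.
  rewrite (_ : th2 = x + be); last by rewrite /be; ring.
  by rewrite sinD cosB cosD; ring.
have sub : sin (al + be) <= sin be + sin al.
  rewrite sinD addrC; apply: lerD.
    by rewrite mulrC ler_piMr// cos_le1.
  by rewrite ler_piMr// cos_le1.
rewrite -/m -(ler_pM2r sD) id1.
apply: (@le_trans _ _ (m * (sin be + sin al))); first by rewrite ler_pM2l.
by rewrite mulrDr lerD// ler_wpM2r.
Qed.

(** The Gamma integrand [exp (- a exp x + (w + i tau) x)] on the line
    [x = s + i th]. *)
Definition rotE a w tau th s : R[i] :=
  cexp (- (a%:C * cexp (s +i* th)) + (w +i* tau) * (s +i* th)).

Lemma Re_rotE a w tau th s : cRe (rotE a w tau th s) = rotK a w tau 0 th s.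
Proof.
rewrite /rotE /rotK /cexp /= /rotA /rotB.
by congr (expR _ * cos _); ring.
Qed.

Lemma Im_rotE a w tau th s :
  cIm (rotE a w tau th s) = rotK a w tau (- (pi / 2)) th s.
Proof.
rewrite /rotE /rotK /cexp /= /rotA /rotB cosB cos_pihalf sin_pihalf.
rewrite mulr0 mulr1 add0r.
by congr (expR _ * sin _); ring.
Qed.

Lemma Cintegrable_rotE a w tau th : 0 < a -> 0 < w -> 0 < cos th ->
  Cintegrable leb (rotE a w tau th).
Proof.
move=> a0 w0 c0; split.
  under eq_fun do rewrite Re_rotE.
  exact: (integrable_rotK tau a0 w0 c0 0 (lexx (cos th))).
under eq_fun do rewrite Im_rotE.
exact: (integrable_rotK tau a0 w0 c0 _ (lexx (cos th))).
Qed.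

Lemma Cintegral_rotE_shift a w tau th1 th2 : 0 < a -> 0 < w ->
  0 < cos th1 -> 0 < cos th2 -> `|th2 - th1| < pi / 2 ->
  Cintegral leb (rotE a w tau th1) = Cintegral leb (rotE a w tau th2).
Proof.
move=> a0 w0.
wlog th12 : th1 th2 / th1 <= th2.
  move=> H c1 c2 d; have [/H|/ltW/H] := leP th1 th2; first exact.
  by move=> -> //; rewrite distrC.
move=> c1 c2; rewrite ger0_norm ?subr_ge0// => d.
have m0 : 0 < Num.min (cos th1) (cos th2) by rewrite lt_min c1 c2.
have kc x : th1 <= x <= th2 -> Num.min (cos th1) (cos th2) <= cos x.
  by move=> xI; exact: min_cos_le.
have E th : Cintegral leb (rotE a w tau th) =
    Rintegral leb setT (rotK a w tau 0 th) +i*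
    Rintegral leb setT (rotK a w tau (- (pi / 2)) th).
  congr (_ +i* _); apply: eq_Rintegral => s _; first exact: Re_rotE.
  exact: Im_rotE.
by rewrite !E; congr (_ +i* _);
  exact: (rotJ_shift tau _ a0 w0 m0 th12 kc).
Qed.

(** The integrand at frequency [0], up to a constant: the frequency [tau] only
    enters through a plane wave ([rotE_factor]). *)
Definition rotG a w th s : R[i] :=
  cexp (- (a%:C * cexp (s +i* th)) + (w * s)%:C).

Definition fourier (g : R -> R[i]) tau : R[i] :=
  Cintegral leb (fun s => g s * cexp (0 +i* (tau * s))).

Lemma rotE_factor a w tau th s :
  rotE a w tau th s = cexp ((- (tau * th)) +i* (w * th)) *
    (rotG a w th s * cexp (0 +i* (tau * s))).
Proof.
rewrite /rotE /rotG -!cexpD; congr cexp.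
rewrite [RHS]addrC -!addrA; congr (_ + _).
by apply: eq_ReIm; rewrite ?ReD ?ImD /=; ring.
Qed.

Lemma normc_rotG a w th s : normc (rotG a w th s) = expR (rotA a w 0 th s).
Proof.
rewrite /rotG normc_cexp ReD ReN /rotA /=; congr expR.
by ring.
Qed.

Lemma rotG_le a w th s : 0 < a -> 0 < w -> 0 < cos th ->
  normc (rotG a w th s) <= expR (4 * w ^+ 2 / (a * cos th)) * expN w s.
Proof.
move=> a0 w0 c0; rewrite normc_rotG.
have := le_expR_rotA 0 s a0 (ltW w0) c0 (lexx _) (lexx `|th|).
by rewrite normr0 mul0r expR0 mul1r.
Qed.

Lemma continuous_rotG a w th :
  continuous (fun s => cRe (rotG a w th s)) /\
  continuous (fun s => cIm (rotG a w th s)).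
Proof.
have cE : continuous (@expR R) by exact: continuous_expR.
split; rewrite /rotG /cexp /=.
  by apply: is_derive_continuous.
by apply: is_derive_continuous.
Qed.

Lemma normc_twist tau s : normc (cexp (0 +i* (tau * s)) : R[i]) = 1.
Proof. by rewrite normc_cexp /= expR0. Qed.

Lemma cmeasurable_cont (f : R -> R[i]) :
  continuous (fun s => cRe (f s)) -> continuous (fun s => cIm (f s)) ->
  cmeasurable (f : measurableTypeR R -> _).
Proof. by move=> cr ci; split; exact: continuous_measurable_fun. Qed.

Lemma cmeasurable_twist tau :
  cmeasurable (fun s : measurableTypeR R => cexp (0 +i* (tau * s)) : R[i]).
Proof.
apply: cmeasurable_cexp; split => /=; first exact: measurable_cst.
exact: measurable_funM.
Qed.

Lemma Cintegrable_twist (g : R -> R[i]) (h : R -> R) tau :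
  cmeasurable (g : measurableTypeR R -> _) ->
  leb.-integrable setT (EFin \o h) -> (forall s, normc (g s) <= h s) ->
  Cintegrable leb (fun s => g s * cexp (0 +i* (tau * s))).
Proof.
move=> mg ih gh; apply: (Cintegrable_le _ ih).
  by apply: cmeasurable_mul => //; exact: cmeasurable_twist.
by move=> s; rewrite ComplexField.Normc.normcM normc_twist mulr1.
Qed.

Lemma fourier_le (g : R -> R[i]) (h : R -> R) tau :
  cmeasurable (g : measurableTypeR R -> _) ->
  leb.-integrable setT (EFin \o h) -> (forall s, normc (g s) <= h s) ->
  normc (fourier g tau) <= 2 * Rintegral leb setT h.
Proof.
move=> mg ih gh; apply: le_normc_Cintegral => //.
  exact: Cintegrable_twist ih gh.
by move=> s; rewrite ComplexField.Normc.normcM normc_twist mulr1.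
Qed.

Lemma Cintegral_rotE a w tau th : 0 < a -> 0 < w -> 0 < cos th ->
  Cintegral leb (rotE a w tau th) =
  cexp ((- (tau * th)) +i* (w * th)) * fourier (rotG a w th) tau.
Proof.
move=> a0 w0 c0; under eq_Cintegral do rewrite rotE_factor.
rewrite CintegralZ//.
have [cr ci] := continuous_rotG a w th.
apply: (Cintegrable_twist _ (cmeasurable_cont cr ci)
  (integrableZl measurableT _ (integrable_expN w0))).
by move=> s; exact: rotG_le.
Qed.

(** Turning the line by a small angle [d] multiplies the Fourier transform at
    [tau] by [exp (tau d)] or its inverse, according to the sense of the
    rotation. The turned transform is bounded, so turning in the sense given by
    the sign of [tau] yields the decay [exp (- d |tau|)]. *)
Lemma fourier_rotG_decay a w th : 0 < a -> 0 < w -> 0 < cos th ->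
  exists C d, 0 < d /\
    forall tau, normc (fourier (rotG a w th) tau) <= C * expN d tau.
Proof.
move=> a0 w0 c0.
have := @continuous_cos R th => /cvgrPdist_lt /(_ _ c0) /nbhs_ballP[e /= e0 be].
pose d := Num.min (e / 2) (pi / 4).
have d0 : 0 < d by rewrite lt_min !divr_gt0// pi_gt0.
have [de dp] : d <= e / 2 /\ d <= pi / 4 by rewrite /d !ge_min !lexx orbT.
have cpos x : `|x - th| <= d -> 0 < cos x.
  move=> xd; have := be x; rewrite /ball/= distrC.
  have xe : `|x - th| < e by lra.
  by move=> /(_ xe); rewrite ltr_norml => /andP[_]; lra.
pose B x := 2 * Rintegral leb setT
  (fun s => expR (4 * w ^+ 2 / (a * cos x)) * expN w s).
have Bx x tau : 0 < cos x -> normc (fourier (rotG a w x) tau) <= B x.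
  move=> cx; have [cr ci] := continuous_rotG a w x.
  apply: (fourier_le _ (cmeasurable_cont cr ci)
    (integrableZl measurableT _ (integrable_expN w0))).
  by move=> s; exact: rotG_le.
have shift x tau : `|x - th| <= d ->
    normc (fourier (rotG a w th) tau) =
    expR (tau * (th - x)) * normc (fourier (rotG a w x) tau).
  move=> xd; have cx := cpos x xd.
  have xp : `|x - th| < pi / 2 by have := pi_gt0 R; lra.
  have := Cintegral_rotE_shift tau a0 w0 c0 cx xp.
  rewrite !Cintegral_rotE// => /(congr1 (fun x => normc x)).
  rewrite !ComplexField.Normc.normcM !normc_cexp /= => H.
  have -> : expR (tau * (th - x)) = expR (tau * th) * expR (- (tau * x)).
    by rewrite -expRD; congr expR; ring.
  by rewrite -mulrA -H mulrA -expRD subrr expR0 mul1r.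
suff H tau : normc (fourier (rotG a w th) tau) <=
    Num.max (B (th + d)) (B (th - d)) * expN d tau.
  by exists (Num.max (B (th + d)) (B (th - d))), d.
have thd : `|th + d - th| <= d by rewrite addrC addKr gtr0_norm.
have thd' : `|th - d - th| <= d by rewrite addrC addKr normrN gtr0_norm.
have [t0|t0] := leP 0 tau.
  rewrite (shift (th + d) tau thd) mulrC ler_pM ?normc_ge0 ?expR_ge0//.
    by rewrite le_max Bx// cpos.
  by rewrite /expN ger0_norm// ler_expR; lra.
rewrite (shift (th - d) tau thd') mulrC ler_pM ?normc_ge0 ?expR_ge0//.
  by rewrite le_max Bx ?orbT// cpos.
by rewrite /expN ltr0_norm// ler_expR; lra.
Qed.

End gamma_factor.

(** * Integrability along subspaces *)

Section exponential_product.
Context {R : realType}.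
Local Notation leb := (@lebesgue_measure R).
Local Notation mu := (lebesgue_tuple R).
Local Notation tup m := (m.-tuple (measurableTypeR R)).
Implicit Types d : R.

Definition expP d m (x : 'rV[R]_m) : R := \prod_i expN d (x 0 i).

Lemma expN_ge0 d (s : R) : 0 <= expN d s. Proof. exact: expR_ge0. Qed.

Lemma expN_le1 d (s : R) : 0 <= d -> expN d s <= 1.
Proof.
by move=> d0; rewrite /expN -expR0 ler_expR oppr_le0 mulr_ge0.
Qed.

Lemma expP_ge0 d m (x : 'rV[R]_m) : 0 <= expP d x.
Proof. by apply: prodr_ge0 => i _; exact: expN_ge0. Qed.

(** Moving the point by a bounded amount costs a constant factor; this dominates
    all the small translates of an integrand at once. *)
Lemma expP_shift d e m (x y : 'rV[R]_m) : 0 <= d -> 0 <= e <= 1 ->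
  expP d (x + e *: y) <= expR (d * \sum_i `|y 0 i|) * expP d x.
Proof.
move=> d0 /andP[e0 e1].
have -> : expR (d * \sum_i `|y 0 i|) = \prod_i expR (d * `|y 0 i|).
  by rewrite mulr_sumr expR_sum.
rewrite /expP -big_split/=; apply: ler_prod => i _; rewrite expN_ge0/=.
rewrite /expN -expRD ler_expR !mxE.
have h1 := ler_normB (x 0 i + e * y 0 i) (e * y 0 i); rewrite addrK in h1.
have h2 : `|e * y 0 i| <= `|y 0 i| by rewrite normrM ger0_norm// ler_piMl.
have h3 : d * `|x 0 i| <= d * (`|x 0 i + e * y 0 i| + `|y 0 i|).
  by rewrite ler_wpM2l//; lra.
rewrite mulrDr in h3; lra.
Qed.

(** The factors are at most [1], so they may be dropped. *)
Lemma expP_colsub d m r (f : 'I_m -> 'I_r) (x : 'rV[R]_r) : 0 <= d ->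
  injective f -> expP d x <= expP d (colsub f x).
Proof.
move=> d0 finj; rewrite /expP.
rewrite (bigID (mem (codom f)))/= -[leRHS]mulr1 ler_pM//.
- by apply: prodr_ge0 => i _; exact: expN_ge0.
- by apply: prodr_ge0 => i _; exact: expN_ge0.
- under [leRHS]eq_bigr do rewrite mxE.
  rewrite le_eqVlt; apply/orP; left; apply/eqP.
  have ucod : uniq (codom f) by rewrite map_inj_uniq// enum_uniq.
  by rewrite -(big_uniq _ ucod) big_map big_enum.
- by apply: prodr_ile1 => i _; rewrite expN_ge0 expN_le1.
Qed.

Lemma integral_expP_tuple d m : 0 < d ->
  (\int[mu m]_s (\prod_i expN d (tnth s i))%:E = ((2 / d) ^+ m)%:E)%E.
Proof.
move=> d0; rewrite (ge0_integral_prod (F := fun=> expN d)).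
- under eq_bigr do rewrite integral_expN//.
  by rewrite prodEFin prodr_const card_ord.
- by move=> i; apply: continuous_measurable_fun; exact: continuous_expN.
- by move=> i x; exact: expN_ge0.
Qed.

Lemma measurable_expP d m r (A : 'M[R]_(m, r)) (x0 : 'rV[R]_r) :
  measurable_fun setT (fun s : tup m => expP d (x0 + rowt s *m A)).
Proof.
apply: measurable_prod => i _.
exact: measurableT_comp (continuous_measurable_fun (@continuous_expN _ d))
  (measurable_rowt A x0 i).
Qed.

(** A full rank family of columns of [V] gives [m] coordinates in which the
    remaining product is that of [m] integrable functions of one variable. The
    bound does not depend on [x0], by invariance under translations. *)
Lemma integrable_expP_tuple d m : 0 < d ->
  (mu m).-integrable setT (fun s => (\prod_i expN d (tnth s i))%:E).
Proof.
move=> d0; apply/integrableP; split.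
  apply/measurable_EFinP; have := @measurable_expP d m m 1%:M 0.
  apply: eq_measurable_fun => s _; apply: eq_bigr => i _.
  by rewrite mulmx1 add0r mxE.
have p0 (s : m.-tuple R) : 0 <= \prod_i expN d (tnth s i).
  by apply: prodr_ge0 => i _; exact: expN_ge0.
under eq_integral do rewrite /= ger0_norm//.
by rewrite integral_expP_tuple// ltry.
Qed.

Lemma integrable_expP d m r (V : 'M[R]_(m, r)) : 0 < d -> row_free V ->
  exists B, forall x0 : 'rV[R]_r,
    (mu m).-integrable setT (fun s => (expP d (x0 + rowt s *m V))%:E) /\
    Rintegral (mu m) setT (fun s => expP d (x0 + rowt s *m V)) <= B.
Proof.
move=> d0 Vfree.
have Vfull : row_full V^T by rewrite /row_full mxrank_tr.
pose f := fullrankfun Vfull; pose A := colsub f V.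
have uA : A \in unitmx.
  suff <- : (rowsub f V^T)^T = A by rewrite unitmx_tr fullrowsub_unit.
  by apply/matrixP => i j; rewrite !mxE.
have dA : \det A != 0 by rewrite -unitfE -unitmxE.
have K0 : 0 < `|\det A| by rewrite normr_gt0.
have finj : injective f by exact: fullrankfun_inj.
exists (`|\det A|^-1 * (2 / d) ^+ m) => x0.
pose x1 := colsub f x0.
have mA := @measurable_aff R m m A x1.
pose h (s : tup m) := \prod_i expN d (tnth s i).
have ih := integrable_expP_tuple m d0.
have mh : measurable_fun setT h.
  by apply/measurable_EFinP; exact: (measurable_int _ ih).
have tr := transfer_aff x1 uA.
have hE s : h (aff A x1 s) = expP d (x1 + rowt s *m A).
  by apply: eq_bigr => i _; rewrite tnth_mktuple.
have iA : (mu m).-integrable setT (fun s => (expP d (x1 + rowt s *m A))%:E).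
  have := (transfer_integrable mA K0 tr mh).1 ih.
  by apply: eq_integrable => // s _; rewrite /= hE.
have le s : expP d (x0 + rowt s *m V) <= expP d (x1 + rowt s *m A).
  apply: le_trans (expP_colsub _ (ltW d0) finj) _.
  rewrite le_eqVlt; apply/orP; left; apply/eqP; congr expP.
  apply/rowP => j; rewrite !mxE; congr (_ + _).
  by apply: eq_bigr => i _; rewrite !mxE.
have iV : (mu m).-integrable setT (fun s => (expP d (x0 + rowt s *m V))%:E).
  apply: le_integrable iA => //.
    by apply/measurable_EFinP; exact: measurable_expP.
  by move=> s _ /=; rewrite lee_fin !ger0_norm ?expP_ge0.
split=> //; apply: (le_trans (le_Rintegral measurableT iV iA (fun s _ => le s))).
rewrite le_eqVlt; apply/orP; left; apply/eqP.
have := transfer_Rintegral mA K0 tr ih.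
rewrite {1}/Rintegral integral_expP_tuple//= => ->.
rewrite mulKf ?gt_eqF//; apply: eq_Rintegral => s _.
by rewrite /= -hE.
Qed.

End exponential_product.

(** * Fourier inversion on an affine slice *)

Section slice_inversion.
Context {R : realType} (n k : nat).
Local Notation leb := (@lebesgue_measure R).
Local Notation mu := (lebesgue_tuple R).
Local Notation tup m := (m.-tuple (measurableTypeR R)).
Local Notation r := (n + k)%N.
Variables (g : 'I_r -> R -> R[i]) (C d : R).
Hypotheses (d0 : 0 < d)
  (cgr : forall i, continuous (fun s => cRe (g i s)))
  (cgi : forall i, continuous (fun s => cIm (g i s)))
  (gle : forall i s, normc (g i s) <= C * expN d s)
  (fle : forall i tau, normc (fourier (g i) tau) <= C * expN d tau).
Variables (L : 'M[R]_(r, k)) (V : 'M[R]_(n, r)) (W : 'M[R]_(k, r)).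
Hypotheses (VL : V *m L = 0) (WL : W *m L = 1%:M)
  (uM : col_mx V W \in unitmx).
Variable x0 : 'rV[R]_r.

Let gP (s : r.-tuple R) : R[i] := \prod_i g i (tnth s i).

Let dot m (v : m.-tuple R) (h : 'rV[R]_m) : R := \sum_a tnth v a * h 0 a.

(** The Fourier transform of [prod_i g_i (s_i)] at the frequency [v L^T], times
    the plane wave that recentres it at the point [x0 L]. *)
Definition slice_transform (v : k.-tuple R) : R[i] :=
  (\prod_i fourier (g i) ((rowt v *m L^T) 0 i)) *
  cexp (0 +i* (- dot v (x0 *m L))).

Let mg i : cmeasurable (g i : measurableTypeR R -> _).
Proof. by apply: cmeasurable_cont. Qed.

Let Cge0 : 0 <= C ^+ r.
Proof.
have [->|r0] := eqVneq r 0%N; first by rewrite expr0.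
have i : 'I_r by apply: (Ordinal (n := r) (m := 0)); rewrite lt0n.
apply: exprn_ge0; have := le_trans (normc_ge0 _) (gle i 0).
by rewrite pmulr_lge0// expR_gt0.
Qed.

Let mgP : cmeasurable (gP : tup r -> _).
Proof.
apply: cmeasurable_prod => i; have [mr mi] := mg i.
by split; [exact: measurableT_comp mr (measurable_tnth i)|
           exact: measurableT_comp mi (measurable_tnth i)].
Qed.

Let gP_le (s : r.-tuple R) : normc (gP s) <= C ^+ r * expP d (rowt s).
Proof.
rewrite /gP normc_prod.
have -> : C ^+ r * expP d (rowt s) = \prod_i (C * expN d (tnth s i)).
  rewrite big_split/= prodr_const card_ord; congr (_ * _).
  by apply: eq_bigr => i _; rewrite mxE.
by apply: ler_prod => i _; rewrite normc_ge0 gle.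
Qed.

Let LTfree : row_free L^T.
Proof.
apply/row_freeP; exists W^T.
by rewrite -trmx_mul WL trmx1.
Qed.

Let dot_fourier v s :
  dot v (rowt s *m L) = \sum_i (rowt v *m L^T) 0 i * tnth s i.
Proof.
rewrite /dot; under eq_bigr => a _ do rewrite mxE mulr_sumr.
rewrite exchange_big; apply: eq_bigr => i _; rewrite [in RHS]mxE mulr_suml.
by apply: eq_bigr => a _; rewrite !mxE; ring.
Qed.

Let wave (v : k.-tuple R) (s : r.-tuple R) : R[i] :=
  cexp (0 +i* dot v (rowt s *m L - x0 *m L)).

Let normc_wave v s : normc (wave v s) = 1.
Proof. by rewrite normc_cexp expR0. Qed.

Let wave_split v s : wave v s =
  cexp (0 +i* (- dot v (x0 *m L))) *
  \prod_i cexp (0 +i* ((rowt v *m L^T) 0 i * tnth s i)).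
Proof.
rewrite -cexp_sum -cexpD; congr cexp; apply: eq_ReIm.
  rewrite ReD /= add0r.
  by rewrite (big_morph _ (@ReD R) (erefl : cRe 0 = 0)) big1.
rewrite ImD (big_morph _ (@ImD R) (erefl : cIm 0 = 0))/= -dot_fourier.
rewrite /dot -sumrN -big_split/=; apply: eq_bigr => a _.
by rewrite !mxE; ring.
Qed.

Let slice_transformE v : 
  slice_transform v = Cintegral (mu r) (fun s => gP s * wave v s).
Proof.
pose f i s := g i s * cexp (0 +i* ((rowt v *m L^T) 0 i * s)).
have fi i : Cintegrable leb (f i).
  exact: (Cintegrable_twist _ (mg i)
    (integrableZl measurableT C (integrable_expN d0)) (gle i)).
have [iP PE] := Cintegral_prod fi.
rewrite /slice_transform mulrC.
have -> : \prod_i fourier (g i) ((rowt v *m L^T) 0 i) =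
    \prod_i Cintegral leb (f i) by [].
rewrite -PE -CintegralZ//; apply: eq_Cintegral => s.
by rewrite wave_split mulrCA -big_split.
Qed.

Let measurable_dot : measurable_fun setT
  (fun p : tup k * tup r => dot p.1 (rowt p.2 *m L - x0 *m L)).
Proof.
apply: measurable_sum => a; apply: measurable_funM.
  exact: measurableT_comp (measurable_tnth a) measurable_fst.
have := measurableT_comp (measurable_rowt L (- (x0 *m L)) a)
  (@measurable_snd _ _ (tup k) (tup r)).
by apply: eq_measurable_fun => p _ /=; rewrite addrC.
Qed.

Let igP : (mu r).-integrable setT
  (fun s => (C ^+ r * expP d (rowt s))%:E).
Proof.
have := integrableZl measurableT (C ^+ r) (integrable_expP_tuple r d0).
apply: eq_integrable => // s _ /=; rewrite EFinM; congr (_ * _%:E)%E.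
by apply: eq_bigr => i _; rewrite mxE.
Qed.

Let iW v : Cintegrable (mu r) (fun s => gP s * wave v s).
Proof.
apply: (Cintegrable_le _ igP).
  apply: cmeasurable_mul => //; apply: cmeasurable_cexp; split => /=.
    exact: measurable_cst.
  exact: (measurable_fun_pair2 v measurable_dot).
by move=> s; rewrite ComplexField.Normc.normcM normc_wave mulr1.
Qed.

Section regularized.
Variable e : R.
Hypothesis e0 : 0 < e.

Let K (v : k.-tuple R) : R := \prod_a expN e (tnth v a).

Let K_ge0 v : 0 <= K v.
Proof. by apply: prodr_ge0 => a _; exact: expN_ge0. Qed.

Let mK : measurable_fun setT (K : tup k -> R).
Proof.
by apply/measurable_EFinP; exact: (measurable_int _ (integrable_expP_tuple k e0)).
Qed.

Let H (p : tup k * tup r) : R[i] := (K p.1)%:C * (gP p.2 * wave p.1 p.2).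

Let mH : cmeasurable H.
Proof.
apply: cmeasurable_mul.
  apply: cmeasurable_real; exact: measurableT_comp mK measurable_fst.
apply: cmeasurable_mul.
  by split; [exact: measurableT_comp mgP.1 measurable_snd|
             exact: measurableT_comp mgP.2 measurable_snd].
apply: cmeasurable_cexp; split => /=; first exact: measurable_cst.
exact: measurable_dot.
Qed.

Let iH : Cintegrable (mu k \x mu r)%E H.
Proof.
apply: (Cintegrable_le mH (integrable_mul_prod (integrable_expP_tuple k e0) igP)).
move=> p; rewrite !ComplexField.Normc.normcM normc_wave mulr1 normc_real.
by rewrite ger0_norm// ler_wpM2l.
Qed.

Let iH1 v : Cintegrable (mu r) (fun s => H (v, s)).
Proof. by have := CintegrableZ (K v)%:C (iW v). Qed.

Let iH2 s : Cintegrable (mu k) (fun v => H (v, s)).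
Proof.
apply: (Cintegrable_le _
  (integrableZl measurableT (normc (gP s)) (integrable_expP_tuple k e0))).
  by split; [exact: (measurable_fun_pair1 s mH.1)|
             exact: (measurable_fun_pair1 s mH.2)].
move=> v; rewrite !ComplexField.Normc.normcM normc_wave mulr1 normc_real.
by rewrite mulrC ger0_norm.
Qed.

Let transformE v :
  Cintegral (mu r) (fun s => H (v, s)) = (K v)%:C * slice_transform v.
Proof.
by rewrite slice_transformE -(CintegralZ _ (iW v)).
Qed.

Let poissonP (h : 'rV[R]_k) : R := \prod_a poisson e (h 0 a).

Let kernelE s : Cintegral (mu k) (fun v => H (v, s)) =
  gP s * (poissonP (rowt s *m L - x0 *m L))%:C.
Proof.
set h := rowt s *m L - x0 *m L.
pose f a (v : R) := (expN e v)%:C * cexp (0 +i* (h 0 a * v)).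
have [iP PE] := Cintegral_prod (fun a => (Cintegral_laplace (h 0 a) e0).1).
rewrite /poissonP rmorph_prod/=.
under eq_bigr => a _ do rewrite -(Cintegral_laplace (h 0 a) e0).2.
rewrite -PE -CintegralZ//; apply: eq_Cintegral => v.
rewrite /H /= mulrCA big_split/= -rmorph_prod/= -cexp_sum; congr (_ * (_ * cexp _)).
apply: eq_ReIm.
  by rewrite (big_morph _ (@ReD R) (erefl : cRe 0 = 0)) big1.
rewrite (big_morph _ (@ImD R) (erefl : cIm 0 = 0))/=.
by apply: eq_bigr => a _; rewrite mulrC.
Qed.

(** The factor [exp (- e |v|)] makes the double integral over [v] and [s]
    absolutely convergent. Integrating [v] first leaves a product of Poisson
    kernels, concentrated near the fibre [s L = x0 L]. *)
Lemma regularized_transform :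
  cmeasurable (slice_transform : tup k -> _) /\
  Cintegral (mu k) (fun v => (\prod_a expN e (tnth v a))%:C * slice_transform v) =
  Cintegral (mu r) (fun s => gP s * (poissonP (rowt s *m L - x0 *m L))%:C) /\
  Cintegrable (mu r) (fun s => gP s * (poissonP (rowt s *m L - x0 *m L))%:C).
Proof.
have [i1 E1] := Cintegral_fubini1 iH iH1.
have [i2 E2] := Cintegral_fubini2 iH iH2.
split; last split.
- have mi := Cintegrable_measurable (eq_Cintegrable transformE i1).
  have mKV : measurable_fun setT (fun v : tup k => \prod_a expN (- e) (tnth v a)).
    apply: measurable_prod => a _.
    exact: measurableT_comp (continuous_measurable_fun (@continuous_expN _ (- e)))
      (measurable_tnth a).
  have := cmeasurable_mul (cmeasurable_real mKV) mi.
  congr cmeasurable; apply/funext => v.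
  rewrite mulrA -rmorphM -big_split/= big1 ?mul1r// => a _.
  by rewrite -expRD mulNr opprK subrr expR0.
- by rewrite -(eq_Cintegral _ transformE) E1 -E2; exact: eq_Cintegral.
- exact: eq_Cintegrable kernelE i2.
Qed.

End regularized.


Let Vfree : row_free V.
Proof.
apply/row_freeP; exists (lsubmx (invmx (col_mx V W))).
rewrite mulmx_lsub -[V in V *m _](col_mxKu V W) mul_usub_mx (mulmxV uM).
by rewrite scalar_mx_block col_mxKu row_mxKl.
Qed.

Let Phi (e : R) (h : k.-tuple R) : R[i] :=
  Cintegral (mu n) (fun y => gP (slice V (e *: W) x0 (y, h))).

Let gP_slice_le e (y : n.-tuple R) (h : k.-tuple R) :
  normc (gP (slice V (e *: W) x0 (y, h))) <=
  C ^+ r * expP d ((x0 + e *: (rowt h *m W)) + rowt y *m V).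
Proof.
by apply: (le_trans (gP_le _)); rewrite rowt_slice/= -scalemxAr addrCA addrC.
Qed.

Let mgP_slice e (h : k.-tuple R) :
  cmeasurable (fun y : tup n => gP (slice V (e *: W) x0 (y, h))).
Proof.
have mS := measurable_slice V (e *: W) x0.
by split; [exact: (measurable_fun_pair1 h (measurableT_comp mgP.1 mS))|
           exact: (measurable_fun_pair1 h (measurableT_comp mgP.2 mS))].
Qed.

Let expP_slice : exists B, forall x1 : 'rV[R]_r,
  (mu n).-integrable setT (fun y => (C ^+ r * expP d (x1 + rowt y *m V))%:E) /\
  2 * Rintegral (mu n) setT (fun y => C ^+ r * expP d (x1 + rowt y *m V)) <= B.
Proof.
have [B HB] := integrable_expP d0 Vfree.
exists (2 * (`|C ^+ r| * B)) => x1; have [ix xB] := HB x1; split.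
  exact: (integrableZl measurableT (C ^+ r) ix).
rewrite RintegralZl// ler_wpM2l//.
apply: (@le_trans _ _ (`|C ^+ r| * Rintegral (mu n) setT
    (fun y => expP d (x1 + rowt y *m V)))).
  rewrite ler_wpM2r ?ler_norm//; apply: Rintegral_ge0 => y _.
  exact: expP_ge0.
by rewrite ler_wpM2l.
Qed.

Let iS e h : Cintegrable (mu n) (fun y => gP (slice V (e *: W) x0 (y, h))).
Proof.
have [B HB] := expP_slice.
exact: Cintegrable_le (mgP_slice e h) (HB _).1 (fun y => gP_slice_le e y h).
Qed.

Let poisson1P (h : k.-tuple R) : R := \prod_a poisson 1 (tnth h a).

Let col_mx_scale e :
  col_mx V (e *: W) = block_mx 1%:M 0 0 e%:M *m col_mx V W.
Proof. by rewrite mul_block_col mul1mx !mul0mx addr0 add0r mul_scalar_mx. Qed.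

(** The substitution [s = x0 + y V + e h W] contributes [e ^+ k] times the
    determinant, and the powers of [e] are absorbed by the dilation of the
    Poisson kernels ([poisson_scale]). *)
Lemma regularized_slice (e : R) : 0 < e ->
  cmeasurable (fun h : tup k => (poisson1P h)%:C * Phi e h) /\
  Cintegral (mu k) (fun v => (\prod_a expN e (tnth v a))%:C * slice_transform v) =
  `|\det (col_mx V W)|%:C * Cintegral (mu k) (fun h => (poisson1P h)%:C * Phi e h).
Proof.
move=> e0; have [_ [-> fi]] := regularized_transform e0.
set f := (X in Cintegrable _ X) in fi *.
have uMe : col_mx V (e *: W) \in unitmx.
  rewrite col_mx_scale unitmx_mul uM andbT unitmxE det_ublock det1 mul1r.
  by rewrite det_scalar unitfE expf_neq0// gt_eqF.
have detE : `|\det (col_mx V (e *: W))| = e ^+ k * `|\det (col_mx V W)|.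
  rewrite col_mx_scale det_mulmx det_ublock det1 mul1r det_scalar.
  by rewrite normrM ger0_norm// exprn_ge0// ltW.
have det0 : 0 < `|\det (col_mx V (e *: W))|.
  by rewrite normr_gt0 -unitfE -unitmxE.
have mS := measurable_slice V (e *: W) x0.
have tr := transfer_slice x0 uMe.
have fSi := (transfer_Cintegrable mS det0 tr (Cintegrable_measurable fi)).1 fi.
have fSE p : (f \o slice V (e *: W) x0) p = (\prod_a poisson e (e * tnth p.2 a))%:C *
    gP (slice V (e *: W) x0 p).
  rewrite /f /= mulrC; congr (_%:C * _); apply: eq_bigr => a _; congr poisson.
  rewrite rowt_slice mulmxDl [X in X - _]addrC addrK.
  rewrite mulmxDl -!mulmxA -scalemxAl VL WL mulmx0 add0r.
  by rewrite -scalemxAr mulmx1 !mxE.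
have sec h : Cintegrable (mu n) (fun y => (f \o slice V (e *: W) x0) (y, h)).
  have := CintegrableZ (\prod_a poisson e (e * tnth h a))%:C (iS e h).
  by apply: eq_Cintegrable => y; rewrite fSE.
have [hi hE] := Cintegral_fubini2 fSi sec.
have secE (h : tup k) : Cintegral (mu n) (fun y => (f \o slice V (e *: W) x0) (y, h)) =
    (\prod_a poisson e (e * tnth h a))%:C * Phi e h.
  by rewrite -(CintegralZ _ (iS e h)); apply: eq_Cintegral => y; rewrite fSE.
have pE h : poisson1P h = e ^+ k * \prod_a poisson e (e * tnth h a).
  rewrite /poisson1P -[k in e ^+ k]card_ord -prodr_const -big_split/=.
  by apply: eq_bigr => a _; rewrite poisson_scale.
have hi' := eq_Cintegrable secE hi.
have E (h : tup k) : (poisson1P h)%:C * Phi e h = (e ^+ k)%:C *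
    ((\prod_a poisson e (e * tnth h a))%:C * Phi e h).
  by rewrite pE rmorphM mulrA.
split.
  apply: (Cintegrable_measurable (mu := mu k)).
  exact: (eq_Cintegrable (fun h => esym (E h)) (CintegrableZ (e ^+ k)%:C hi')).
rewrite (transfer_Cintegral mS det0 tr fi) -hE (eq_Cintegral _ secE) detE.
by rewrite (eq_Cintegral _ E) (CintegralZ _ hi') rmorphM/= -mulrA mulrCA.
Qed.


Let transform_le v :
  normc (slice_transform v) <= C ^+ r * expP d (0 + rowt v *m L^T).
Proof.
rewrite /slice_transform ComplexField.Normc.normcM normc_cexp expR0 mulr1.
rewrite normc_prod add0r.
have -> : C ^+ r * expP d (rowt v *m L^T) =
    \prod_i (C * expN d ((rowt v *m L^T) 0 i)).
  by rewrite big_split/= prodr_const card_ord.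
by apply: ler_prod => i _; rewrite normc_ge0 fle.
Qed.

Let iT : (mu k).-integrable setT
  (fun v => (C ^+ r * expP d (0 + rowt v *m L^T))%:E).
Proof.
have [B /(_ 0)[iE _]] := integrable_expP d0 LTfree.
exact: (integrableZl measurableT (C ^+ r) iE).
Qed.

Let mT : cmeasurable (slice_transform : tup k -> _).
Proof. by have [] := regularized_transform ltr01. Qed.

Let eps (j : nat) : R := j.+1%:R^-1.

Let eps0 j : 0 < eps j. Proof. by rewrite invr_gt0. Qed.

Let eps01 j : 0 <= eps j <= 1.
Proof. by rewrite ltW//= invf_le1// ler1n. Qed.

Let cvg_eps : eps @ \oo --> 0.
Proof. exact: cvg_harmonic. Qed.

Let ccvg_real (u : nat -> R) (l : R) : u @ \oo --> l ->
  ccvg (fun j => (u j)%:C) l%:C.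
Proof. by move=> ul; split => //=; exact: cvg_cst. Qed.

Let cvg_lhs : ccvg
  (fun j => Cintegral (mu k) (fun v => (\prod_a expN (eps j) (tnth v a))%:C *
    slice_transform v))
  (Cintegral (mu k) slice_transform).
Proof.
apply: (Cintegral_dominated _ iT).
- move=> j; apply: cmeasurable_mul => //; apply: cmeasurable_real.
  apply/measurable_EFinP.
  exact: (measurable_int _ (integrable_expP_tuple k (eps0 j))).
- move=> j v; rewrite ComplexField.Normc.normcM normc_real.
  apply: le_trans (transform_le v).
  rewrite ler_piMl ?normc_ge0// ger0_norm.
    by apply: prodr_ile1 => a _; rewrite expN_ge0 expN_le1 ?ltW.
  by apply: prodr_ge0 => a _; exact: expN_ge0.
- move=> v; rewrite -[X in ccvg _ X]mul1r; apply: ccvg_mul; last exact: ccvg_cst.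
  rewrite (_ : (fun j => _) =
    fun j => \prod_a (expN (eps j) (tnth v a))%:C); last first.
    by apply/funext => j; rewrite rmorph_prod.
  suff : ccvg (fun j => \prod_a (expN (eps j) (tnth v a))%:C)
      (\prod_(a < k) (1 : R)%:C) by rewrite [X in ccvg _ X -> _]big1.
  apply: (ccvg_prod (U := fun a j => (expN (eps j) (tnth v a))%:C)) => a.
  apply: ccvg_real; rewrite /expN -[X in _ --> X](@expR0 R).
  have c : - (eps j * `|tnth v a|) @[j --> \oo] --> (0 : R).
    rewrite -[X in _ --> X]oppr0 -[X in _ --> - X](mul0r `|tnth v a|).
    by apply: cvgN; apply: cvgM => //; exact: cvg_cst.
  exact: (cvg_comp _ expR c (@continuous_expR R 0)).
Qed.

Let Phi_le : exists B, forall e h, normc (Phi e h) <= B.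
Proof.
have [B HB] := expP_slice; exists B => e h.
have [ix xB] := HB (x0 + e *: (rowt h *m W)).
by apply: le_trans xB; apply: le_normc_Cintegral => // y; exact: gP_slice_le.
Qed.

Let slice0 y h : gP (slice V (0 *: W) x0 (y, h)) =
  \prod_i g i ((x0 + rowt y *m V) 0 i).
Proof.
apply: eq_bigr => i _.
have -> : tnth (slice V (0 *: W) x0 (y, h)) i =
    rowt (slice V (0 *: W) x0 (y, h)) 0 i by rewrite mxE.
by rewrite rowt_slice scale0r mulmx0 addr0.
Qed.

Let cvg_Phi h : ccvg (fun j => Phi (eps j) h) (Phi 0 h).
Proof.
have [B HB] := expP_slice; have [ix _] := HB x0.
pose c := expR (d * \sum_i `|(rowt h *m W) 0 i|).
apply: (Cintegral_dominated _ (integrableZl measurableT c ix)).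
- by move=> j; exact: mgP_slice.
- move=> j y; apply: (le_trans (gP_slice_le _ _ _)) => /=.
  rewrite mulrCA ler_wpM2l// addrAC.
  exact: expP_shift (ltW d0) (eps01 j).
- move=> y; apply: ccvg_prod => i.
  have tE e : tnth (slice V (e *: W) x0 (y, h)) i =
      (x0 + rowt y *m V) 0 i + e * (rowt h *m W) 0 i.
    have -> : tnth (slice V (e *: W) x0 (y, h)) i =
        rowt (slice V (e *: W) x0 (y, h)) 0 i by rewrite mxE.
    by rewrite rowt_slice/= -scalemxAr addrA mxE [X in _ + X = _]mxE.
  have cx : tnth (slice V (eps j *: W) x0 (y, h)) i @[j --> \oo] -->
      tnth (slice V (0 *: W) x0 (y, h)) i.
    under eq_fun do rewrite tE.
    rewrite tE; apply: cvgD; first exact: cvg_cst.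
    by apply: cvgM => //; exact: cvg_cst.
  split; first by have := cvg_comp _ _ cx (@cgr i _).
  by have := cvg_comp _ _ cx (@cgi i _).
Qed.

Let ip1 : Cintegrable (mu k) (fun h => (poisson1P h)%:C) /\
  Cintegral (mu k) (fun h => (poisson1P h)%:C) = ((2 * pi) ^+ k)%:C.
Proof.
have [iP PE] := Cintegral_prod (fun a : 'I_k => (@Cintegral_poisson1 R).1).
have E (h : tup k) : \prod_a (poisson 1 (tnth h a))%:C = (poisson1P h)%:C.
  by rewrite /poisson1P rmorph_prod.
split; first exact: eq_Cintegrable E iP.
rewrite -(eq_Cintegral _ E) PE.
under eq_bigr do rewrite (@Cintegral_poisson1 R).2.
by rewrite prodr_const card_ord rmorphXn.
Qed.

Let cvg_rhs : ccvg
  (fun j => Cintegral (mu k) (fun h => (poisson1P h)%:C * Phi (eps j) h))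
  (Cintegral (mu k) (fun h => (poisson1P h)%:C * Phi 0 h)).
Proof.
have [B PB] := Phi_le.
have p0 h : 0 <= poisson1P h.
  by apply: prodr_ge0 => a _; exact: poisson_ge0.
apply: (Cintegral_dominated _ (integrableZr measurableT B ip1.1.1)).
- by move=> j; have [] := regularized_slice (eps0 j).
- move=> j h; rewrite ComplexField.Normc.normcM normc_real ger0_norm//.
  by rewrite ler_wpM2l.
- by move=> h; apply: ccvg_mul; [exact: ccvg_cst|exact: cvg_Phi].
Qed.

(** A Fourier slice theorem: restricting a Fourier transform to a subspace of
    frequencies and inverting it there integrates the function over a fibre of
    the dual projection. Both sides of [regularized_slice] converge as [e]
    tends to [0]. On the right the limit is taken first over the fibre, for a
    fixed displacement [h], and then over [h]: the Poisson kernel decays too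
    slowly for a single domination in all the variables. *)
Theorem slice_inversion :
  [/\ Cintegrable (mu k) (slice_transform : tup k -> _),
      Cintegrable (mu n)
        (fun y : tup n => \prod_i g i ((x0 + rowt y *m V) 0 i)) &
      Cintegral (mu k) slice_transform =
      ((2 * pi) ^+ k * `|\det (col_mx V W)|)%:C *
      Cintegral (mu n) (fun y => \prod_i g i ((x0 + rowt y *m V) 0 i))].
Proof.
have h0 : k.-tuple R := [tuple 0 | _ < k].
split.
- exact: Cintegrable_le mT iT transform_le.
- by apply: eq_Cintegrable (iS 0 h0) => y; rewrite slice0.
have PE h : Phi 0 h =
    Cintegral (mu n) (fun y => \prod_i g i ((x0 + rowt y *m V) 0 i)).
  by apply: eq_Cintegral => y; rewrite slice0.
have c1 := ccvg_mul (ccvg_cst `|\det (col_mx V W)|%:C) cvg_rhs.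
have := ccvg_unique cvg_lhs; apply.
have E : (fun j => Cintegral (mu k) (fun v =>
      (\prod_a expN (eps j) (tnth v a))%:C * slice_transform v)) =
    (fun j => `|\det (col_mx V W)|%:C *
      Cintegral (mu k) (fun h => (poisson1P h)%:C * Phi (eps j) h)).
  by apply/funext => j; have [] := regularized_slice (eps0 j).
rewrite E; move: c1; congr ccvg.
under eq_Cintegral => h do rewrite PE mulrC.
rewrite CintegralZ ?ip1.2; last exact: ip1.1.
by rewrite rmorphM/=; ring.
Qed.

End slice_inversion.

(** * What absolute convergence forces *)

Section convergence.
Context {R : realType}.
Local Notation leb := (@lebesgue_measure R).
Local Notation mu := (lebesgue_tuple R).
Implicit Types (a w tau th s : R).

Lemma prode_gt0 m (x : 'I_m -> \bar R) (P : pred 'I_m) :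
  (forall i, 0 < x i)%E -> (0 < \prod_(i | P i) x i)%E.
Proof.
move=> x0; elim/big_ind : _ => // y z; exact: mule_gt0.
Qed.

Lemma prode_lty m (x : 'I_m -> \bar R) i : (forall i, 0 < x i)%E ->
  (\prod_i x i < +oo)%E -> (x i < +oo)%E.
Proof.
move=> x0; rewrite (bigD1 i)//= => xy; rewrite ltNge leye_eq; apply/eqP => xi.
by move: xy; rewrite xi gt0_mulye ?ltxx// prode_gt0.
Qed.

Lemma ge0_integral_lower (f : R -> R) (D : set R) (c : R) :
  measurable D -> measurable_fun setT f -> (forall x, 0 <= f x) -> 0 <= c ->
  (forall x, D x -> c <= f x) ->
  (c%:E * leb D <= \int[leb]_x (f x)%:E)%E.
Proof.
move=> mD mf f0 c0 cf.
have mfE : measurable_fun setT (EFin \o f) by exact/measurable_EFinP.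
apply: (@le_trans _ _ (\int[leb]_(x in D) (f x)%:E)%E).
  rewrite -integral_cst//; apply: ge0_le_integral => //.
  - exact: measurable_funTS.
apply: ge0_subset_integral => //.
by move=> x _; rewrite lee_fin.
Qed.

Lemma measurable_expR_rotA a w tau th :
  measurable_fun setT (fun s => expR (rotA a w tau th s)).
Proof.
rewrite /rotA; apply: continuous_measurable_fun.
by apply: is_derive_continuous.
Qed.

Lemma integral_expR_rotA_gt0 a w tau th :
  (0 < \int[leb]_s (expR (rotA a w tau th s))%:E)%E.
Proof.
pose c := expR (- (`|a * cos th| * expR 1 + `|w| + `|tau * th|)).
apply: (@lt_le_trans _ _ (c%:E * leb `[0%R, 1%R])%E).
  rewrite lebesgue_measure_itv/= lte_fin ltr01 oppr0 adde0 mule1 lte_fin.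
  exact: expR_gt0.
apply: ge0_integral_lower => //.
- exact: measurable_expR_rotA.
- exact: expR_ge0.
- move=> s /=; rewrite in_itv/= => /andP[s0 s1]; rewrite /c ler_expR /rotA.
  have h1 : `|a * cos th * expR s| <= `|a * cos th| * expR 1.
    by rewrite normrM (ger0_norm (expR_ge0 _)) ler_wpM2l// ler_expR.
  have h2 : `|w * s| <= `|w| by rewrite normrM (ger0_norm s0) ler_piMr.
  have := ler_norm (a * cos th * expR s); have := ler_norm (tau * th).
  have := ler_norm (- (w * s)); rewrite normrN mulNr; lra.
Qed.

(** If [w <= 0] the integrand is bounded below near minus infinity, and if [w]
    is positive but the cosine is not, it is bounded below near plus
    infinity. *)
Lemma integral_expR_rotA_lty a w tau th : 0 < a ->
  (\int[leb]_s (expR (rotA a w tau th s))%:E < +oo)%E -> 0 < w /\ 0 < cos th.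
Proof.
move=> a0 fin.
have lower (D : set R) c : measurable D -> leb D = +oo%E -> 0 < c ->
    (forall s, D s -> c <= expR (rotA a w tau th s)) -> False.
  move=> mD Doo c0 cD.
  have := ge0_integral_lower mD (measurable_expR_rotA a w tau th)
    (fun s => expR_ge0 _) (ltW c0) cD.
  by rewrite Doo gt0_muley ?lte_fin// leye_eq => /eqP fE; rewrite fE ltxx in fin.
have [w0|w0] := leP w 0.
  exfalso; apply: (lower `]-oo, 0%R]%classic
    (expR (- (`|a * cos th| + `|tau * th|)))) => //.
  - by rewrite lebesgue_measure_itv/= ltNyr.
  - move=> s /=; rewrite in_itv/= => s0; rewrite ler_expR /rotA.
    have h1 : `|a * cos th * expR s| <= `|a * cos th|.
      rewrite normrM (ger0_norm (expR_ge0 _)) ler_piMr//.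
      by rewrite -expR0 ler_expR.
    have h2 : 0 <= w * s by rewrite mulr_le0.
    have := ler_norm (a * cos th * expR s); have := ler_norm (tau * th).
    rewrite mulNr; lra.
split=> //; rewrite ltNge; apply/negP => c0.
apply: (lower `[0%R, +oo[%classic (expR (- (tau * th)))) => //.
- by rewrite lebesgue_measure_itv/= ltry.
- exact: expR_gt0.
- move=> s /=; rewrite in_itv/= andbT => s0; rewrite ler_expR /rotA.
  have h1 : 0 <= - (a * cos th) * expR s.
    by rewrite mulr_ge0 ?expR_ge0// oppr_ge0 mulr_ge0_le0// ltW.
  have h2 : 0 <= w * s by rewrite mulr_ge0// ltW.
  lra.
Qed.

Lemma normc_rotE a w tau th s :
  normc (rotE a w tau th s) = expR (rotA a w tau th s).
Proof.
rewrite rotE_factor !ComplexField.Normc.normcM normc_twist mulr1 normc_cexp.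
by rewrite normc_rotG -expRD; congr expR; rewrite /rotA /=; ring.
Qed.

(** The modulus of a product is the product of the moduli, so an absolutely
    convergent integral of a product forces each factor to be integrable. *)
Lemma rotE_prod_converges m a (w tau th : 'I_m -> R) : 0 < a ->
  Cintegrable (mu m)
    (fun v => \prod_i rotE a (w i) (tau i) (th i) (tnth v i)) ->
  forall i, 0 < w i /\ 0 < cos (th i).
Proof.
move=> a0 fi i; apply: (@integral_expR_rotA_lty a _ (tau i)) => //.
pose x i := (\int[leb]_s (expR (rotA a (w i) (tau i) (th i) s))%:E)%E.
apply: (prode_lty (x := x)) => [j|]; first exact: integral_expR_rotA_gt0.
rewrite -(ge0_integral_prod (F := fun i s => expR (rotA a (w i) (tau i) (th i) s))).
- have /integrableP[_] := Cintegrable_normc fi.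
  congr (_ < _)%E; apply: eq_integral => v _ /=.
  rewrite ger0_norm ?normc_ge0// normc_prod; congr EFin.
  by apply: eq_bigr => j _; exact: normc_rotE.
- by move=> j; exact: measurable_expR_rotA.
- by move=> j s; exact: expR_ge0.
Qed.

Lemma uniform_decay m (P : 'I_m -> R -> R -> Prop) :
  (forall i C C' d d', C <= C' -> d' <= d -> 0 < d' -> P i C d -> P i C' d') ->
  (forall i, exists C d, 0 < d /\ P i C d) ->
  exists C d, 0 < d /\ forall i, P i C d.
Proof.
move=> mono ex.
have /choice[F HF] i : exists p : R * R, 0 < p.2 /\ P i p.1 p.2.
  by have [C [d H]] := ex i; exists (C, d).
(* sums, unlike extrema, need no special treatment of the empty family *)
pose C := \sum_i `|(F i).1|; pose S := 1 + \sum_i (F i).2^-1.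
have S0 : 0 < S.
  by rewrite ltr_wpDr// sumr_ge0// => i _; rewrite invr_ge0 ltW//; have [] := HF i.
exists C, S^-1; split=> [|i]; first by rewrite invr_gt0.
have [d0 Pi] := HF i.
apply: mono Pi; last by rewrite invr_gt0.
  rewrite /C (bigD1 i)//= (le_trans (ler_norm _))// lerDl.
  by apply: sumr_ge0.
rewrite -[leRHS]invrK lef_pV2 ?posrE ?invr_gt0//.
rewrite /S (bigD1 i)//= addrCA lerDl addr_ge0// sumr_ge0// => j _.
by rewrite invr_ge0 ltW//; have [] := HF j.
Qed.

End convergence.

(** * The real geometry of the cycles *)

Section real_parts.
Context {R : realType}.

Lemma Re_sum m (f : 'I_m -> R[i]) : cRe (\sum_i f i) = \sum_i cRe (f i).
Proof. exact: (big_morph _ (@ReD R) erefl). Qed.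

Lemma Im_sum m (f : 'I_m -> R[i]) : cIm (\sum_i f i) = \sum_i cIm (f i).
Proof. exact: (big_morph _ (@ImD R) erefl). Qed.

Lemma Re_mulmx m p q (A : 'M[R]_(m, p)) (B : 'M[R[i]]_(p, q)) :
  map_mx (@complex.Re R) (map_mx (real_complex R) A *m B) =
  A *m map_mx (@complex.Re R) B.
Proof.
apply/matrixP => i j; rewrite !mxE Re_sum; apply: eq_bigr => s _.
by rewrite Re_mul !mxE/= mul0r subr0.
Qed.

Lemma Im_mulmx m p q (A : 'M[R]_(m, p)) (B : 'M[R[i]]_(p, q)) :
  map_mx (@complex.Im R) (map_mx (real_complex R) A *m B) =
  A *m map_mx (@complex.Im R) B.
Proof.
apply/matrixP => i j; rewrite !mxE Im_sum; apply: eq_bigr => s _.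
by rewrite Im_mul !mxE/= mul0r addr0.
Qed.

Lemma Re_mulmxr m p q (A : 'M[R[i]]_(m, p)) (B : 'M[R]_(p, q)) :
  map_mx (@complex.Re R) (A *m map_mx (real_complex R) B) =
  map_mx (@complex.Re R) A *m B.
Proof.
apply/matrixP => i j; rewrite !mxE Re_sum; apply: eq_bigr => s _.
by rewrite Re_mul !mxE/= mulr0 subr0.
Qed.

Lemma mxC_mxR m p (l : 'M[int]_(m, p)) : mxC R l = map_mx (real_complex R) (mxR R l).
Proof. by apply/matrixP => i j; rewrite !mxE rmorph_int. Qed.

Definition tup_of_row m (v : 'rV[R]_m) : m.-tuple R := [tuple v 0 j | j < m].

Lemma rowt_of_row m (v : 'rV[R]_m) : rowt (tup_of_row v) = v.
Proof. by apply/rowP => j; rewrite mxE tnth_mktuple. Qed.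

Lemma parametrizationE m p (F : affine_cycle R m p) (y : m.-tuple R) :
  parametrization F y = base F + map_mx (real_complex R) (rowt y) *m frame F.
Proof. by congr (_ + _ *m _); apply/rowP => j; rewrite !mxE. Qed.

Lemma mirror_cycleE r (c : 'rV[R]_r) s i :
  parametrization (mirror_cycle c) s 0 i = tnth s i +i* (2 * pi * c 0 i).
Proof.
rewrite parametrizationE mulmx1 !mxE.
by apply: eq_ReIm; rewrite /= ?add0r ?addr0.
Qed.

Lemma vertical_cycleE m (gamma : 'rV[R]_m) v a :
  parametrization (vertical_cycle gamma) v 0 a = gamma 0 a +i* tnth v a.
Proof.
rewrite parametrizationE mul_mx_scalar !mxE.
by apply: eq_ReIm; rewrite /= ?mul0r ?mul1r ?mulr0 ?subr0 ?addr0 ?add0r.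
Qed.

End real_parts.

Section cycle_geometry.
Context {R : realType} (n k : nat).
Variables (l : 'M[int]_(n + k, k)) (c : 'rV[R]_(n + k)) (t : 'rV[R[i]]_k).
Variable F : affine_cycle R n (n + k).
Hypotheses
  (hF : locus F = locus (mirror_cycle c) `&`
    \bigcap_(a in [set: 'I_k])
      [set x | complex.Re (Htilde l x 0 a) = complex.Re (t 0 a)])
  (horient : 0 < sign F * Omega l (frame F)).

Definition real_frame : 'M[R]_(n, n + k) := map_mx (@complex.Re R) (frame F).
Definition real_base : 'rV[R]_(n + k) := map_mx (@complex.Re R) (base F).

Local Notation L := (mxR R l).
Local Notation V := real_frame.
Local Notation x0 := real_base.
Local Notation W := (pinvmx (mxR R l)).

Let inF (y : n.-tuple R) :
  (forall i, cIm (parametrization F y 0 i) = 2 * pi * c 0 i) /\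
  (forall a, cRe (Htilde l (parametrization F y) 0 a) = cRe (t 0 a)).
Proof.
have : locus F (parametrization F y) by exists y.
rewrite hF => -[[s _ sE] H]; split=> [i|a]; last exact: H.
by rewrite -sE mirror_cycleE.
Qed.

Let ImF (y : n.-tuple R) : map_mx (@complex.Im R) (base F) +
  rowt y *m map_mx (@complex.Im R) (frame F) = \row_i (2 * pi * c 0 i).
Proof.
rewrite -Im_mulmx; apply/rowP => i; have [/(_ i) + _] := inF y.
by rewrite parametrizationE !mxE ImD.
Qed.

Let mulmx_row_eq0 m p (A : 'M[R]_(m, p)) : (forall v : 'rV_m, v *m A = 0) -> A = 0.
Proof. by move=> vA; apply/row_matrixP => i; rewrite rowE vA row0. Qed.

Let Im_base : map_mx (@complex.Im R) (base F) = \row_i (2 * pi * c 0 i).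
Proof.
by have := ImF (tup_of_row 0); rewrite rowt_of_row mul0mx addr0.
Qed.

Let Im_frame : map_mx (@complex.Im R) (frame F) = 0.
Proof.
apply: mulmx_row_eq0 => v; have := ImF (tup_of_row v).
by rewrite rowt_of_row Im_base -[RHS]addr0 => /addrI.
Qed.

Let frameE : frame F = map_mx (real_complex R) V.
Proof.
apply/matrixP => i j; rewrite !mxE; apply: eq_ReIm => //=.
by move/matrixP : Im_frame => /(_ i j); rewrite !mxE.
Qed.

(** All the points of the cycle have the imaginary parts prescribed by the mirror
    cycle, which forces the frame to be real. *)
Lemma cycle_pointE (y : n.-tuple R) i : parametrization F y 0 i =
  (x0 + rowt y *m V) 0 i +i* (2 * pi * c 0 i).
Proof.
apply: eq_ReIm; last by have [/(_ i) -> _] := inF y.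
rewrite parametrizationE /= /V -Re_mulmx.
by rewrite !mxE ReD.
Qed.

Let ReH (y : n.-tuple R) : (x0 + rowt y *m V) *m L = map_mx (@complex.Re R) t.
Proof.
apply/rowP => a; have [_ /(_ a) H] := inF y.
rewrite [RHS]mxE -H /Htilde mxC_mxR.
rewrite -[RHS]/(cRe ((_ : 'rV[R[i]]_k) 0 a)).
have := Re_mulmxr (parametrization F y) L => /rowP/(_ a).
rewrite mxE => ->; congr (fun_of_matrix (_ *m _) _ _).
by apply/rowP => i; rewrite [RHS]mxE cycle_pointE.
Qed.

Lemma cycle_base_image : x0 *m L = map_mx (@complex.Re R) t.
Proof. by have := ReH (tup_of_row 0); rewrite rowt_of_row mul0mx addr0. Qed.

Lemma cycle_frame_tangent : V *m L = 0.
Proof.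
apply: mulmx_row_eq0 => v; have := ReH (tup_of_row v).
rewrite rowt_of_row mulmxDl cycle_base_image -[RHS]addr0 => /addrI.
by rewrite mulmxA.
Qed.

Let OmegaE : Omega l (frame F) = (\det (col_mx V W))%:C.
Proof.
rewrite /Omega /volume_form frameE mxC_mxR -map_pinvmx -map_col_mx.
exact: det_map_mx.
Qed.

(** Contracting with the rows of the pseudo-inverse makes [Omega] the Jacobian of
    the slice coordinates; the orientation of the cycle makes it positive. *)
Lemma cycle_sign : sign F * Omega l (frame F) = `|\det (col_mx V W)|%:C.
Proof.
move: horient; rewrite OmegaE /sign; case: (reversed F) => /=.
  rewrite expr1 mulN1r -rmorphN/= ltcR => h.
  by rewrite -normrN gtr0_norm.
by rewrite expr0 mul1r ltcR => h; rewrite gtr0_norm.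
Qed.

Lemma cycle_unit : col_mx V W \in unitmx.
Proof.
rewrite unitmxE unitfE -normr_eq0; move: horient; rewrite cycle_sign ltcR.
by move/lt0r_neq0.
Qed.

(** The pseudo-inverse has rank [k] as a block of an invertible matrix, and its
    rank is at most that of [l], which is therefore maximal. *)
Lemma cycle_section : W *m L = 1%:M.
Proof.
apply: mulVpmx.
have Wfree : row_free W.
  apply/row_freeP; exists (rsubmx (invmx (col_mx V W))).
  rewrite mulmx_rsub -[W in W *m _](col_mxKd V) mul_dsub_mx mulmxV ?cycle_unit//.
  by rewrite scalar_mx_block col_mxKd row_mxKr.
rewrite /row_full eqn_leq rank_leq_col/=.
move/eqP : Wfree => {1}<-.
rewrite /pinvmx (leq_trans (mxrankM_maxl _ _))//.
rewrite (leq_trans (mxrankM_maxr _ _))// rank_pid_mx//.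
  exact: rank_leq_col.
exact: rank_leq_row.
Qed.

End cycle_geometry.

(** * From the oscillatory integrals to the slice *)

Section integrands.
Context {R : realType} (r k : nat) (l : 'M[int]_(r, k)) (z : R).
Hypothesis z0 : 0 < z.
Variable gamma : 'rV[R]_k.

Local Notation L := (mxR R l).

(** [weight] and [freq] are the real and imaginary parts of the exponent
    [sum_a l_i^(a) u_a] of [X_i], at [u = gamma + i v]. *)
Definition weight (i : 'I_r) : R := (gamma *m L^T) 0 i.

Definition freq (v : k.-tuple R) (i : 'I_r) : R := (rowt v *m L^T) 0 i.

Let zC : z%:C != 0 :> R[i].
Proof. by rewrite -[0]/((0 : R)%:C) (inj_eq (@complexI R)) gt_eqF. Qed.

Let weight_freqE v i :
  \sum_a (parametrization (vertical_cycle gamma) v) 0 a * mxC R l i a =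
  weight i +i* freq v i.
Proof.
rewrite mxC_mxR; apply: eq_ReIm.
  rewrite Re_sum [RHS]/= /weight mxE; apply: eq_bigr => a _.
  by rewrite vertical_cycleE Re_mul !mxE/= mulr0 subr0.
rewrite Im_sum [RHS]/= /freq mxE; apply: eq_bigr => a _.
by rewrite vertical_cycleE Im_mul !mxE/= mulr0 add0r.
Qed.

Lemma equivariant_integrandE c v s :
  ZB_equivariant_integrand l z (parametrization (vertical_cycle gamma) v)
    (parametrization (mirror_cycle c) s) =
  \prod_i rotE z^-1 (weight i) (freq v i) (2 * pi * c 0 i) (tnth s i).
Proof.
rewrite /ZB_equivariant_integrand /rotE -cexp_sum; congr cexp.
rewrite big_split/= sumrN /equivariant_superpotential opprB mulrBl addrC.
congr (_ + _); last first.
  rewrite /superpotential mulr_suml; congr (- _); apply: eq_bigr => i _.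
  by rewrite mirror_cycleE mulrC fmorphV.
rewrite mulr_suml.
set u := parametrization (vertical_cycle gamma) v.
transitivity (\sum_a \sum_i u 0 a * mxC R l i a *
    parametrization (mirror_cycle c) s 0 i).
  apply: eq_bigr => a _.
  have -> : (z%:C *: u) 0 a = z%:C * u 0 a by rewrite mxE.
  rewrite -!mulrA mulrC -!mulrA mulVf// mulr1.
  rewrite /Htilde [X in _ * X]mxE mulr_sumr; apply: eq_bigr => i _.
  by rewrite mulrCA mulrC.
rewrite exchange_big; apply: eq_bigr => i _.
by rewrite -mulr_suml weight_freqE mirror_cycleE.
Qed.

Lemma superpotential_integrandE (c x : 'rV[R]_r) (y : 'rV[R[i]]_r) :
  (forall i, y 0 i = x 0 i +i* (2 * pi * c 0 i)) ->
  ZB_integrand z y =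
  (expR (- \sum_a gamma 0 a * (x *m L) 0 a))%:C *
  \prod_i rotG z^-1 (weight i) (2 * pi * c 0 i) (x 0 i).
Proof.
move=> yE; rewrite /ZB_integrand /rotG -cexp_sum -cexp_real -cexpD.
congr cexp; rewrite big_split/= sumrN addrCA.
rewrite /superpotential mulNr mulr_suml -[LHS]addr0; congr (- _ + _).
  by apply: eq_bigr => i _; rewrite yE mulrC fmorphV.
rewrite -rmorph_sum -rmorphD/= -[0]/((0 : R)%:C); congr (_%:C).
apply/esym/eqP; rewrite addrC subr_eq0; apply/eqP.
rewrite /weight; under eq_bigr => i _ do rewrite mxE mulr_suml.
rewrite exchange_big; apply: eq_bigr => a _; rewrite mxE mulr_sumr.
by apply: eq_bigr => i _; rewrite !mxE; ring.
Qed.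

End integrands.

Lemma ler_expN (R : realType) (C C' d d' x : R) : 0 <= C -> C <= C' -> d' <= d ->
  C * expN d x <= C' * expN d' x.
Proof.
move=> C0 CC dd; apply: ler_pM => //; first exact: expN_ge0.
by rewrite ler_expR lerN2 ler_wpM2r.
Qed.

Section main.
Context {R : realType} (n k : nat).
Local Notation leb := (@lebesgue_measure R).
Local Notation mu := (lebesgue_tuple R).
Local Notation tup m := (m.-tuple (measurableTypeR R)).
Variables (l : 'M[int]_(n + k, k)) (z : R) (c c' : 'rV[R]_(n + k)).
Variables (t : 'rV[R[i]]_k) (gamma : 'rV[R]_k).
Hypotheses (z0 : 0 < z) (hc : forall i, `|c' 0 i - c 0 i| < 4^-1)
  (ht : forall a, cIm (t 0 a) = 2 * pi * \sum_i (l i a)%:~R * c' 0 i)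
  (hconv : forall u, locus (vertical_cycle gamma) u ->
      ZB_equivariant_converges l z (mirror_cycle c) u /\
      ZB_equivariant_converges l z (mirror_cycle c') u).

Let th (c : 'rV[R]_(n + k)) i : R := 2 * pi * c 0 i.
Local Notation w := (weight l gamma).
Let u v := parametrization (vertical_cycle gamma) v.

Let iz0 : 0 < z^-1. Proof. by rewrite invr_gt0. Qed.

Let converges (d : 'rV[R]_(n + k)) :
  ZB_equivariant_converges l z (mirror_cycle d) (u [tuple 0 | _ < k]) ->
  forall i, 0 < w i /\ 0 < cos (th d i).
Proof.
move=> H; apply: (rotE_prod_converges iz0 (tau := freq l [tuple 0 | _ < k])).
apply: eq_Cintegrable H => s.
by rewrite /volume_form det1 mulr1 equivariant_integrandE.
Qed.

Let weight_cos i : [/\ 0 < w i, 0 < cos (th c i) & 0 < cos (th c' i)].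
Proof.
have [H H'] := hconv (ex_intro2 _ _ _ I erefl : locus _ (u [tuple 0 | _ < k])).
by have [w0 c0] := converges H i; have [_ c0'] := converges H' i.
Qed.

Let th_close i : `|th c' i - th c i| < pi / 2.
Proof.
rewrite /th -mulrBr normrM ger0_norm ?mulr_ge0 ?pi_ge0//.
have := hc i; have := pi_gt0 R => p0 h.
rewrite (_ : pi / 2 = 2 * pi * 4^-1); last by field.
by rewrite ltr_pM2l// mulr_gt0.
Qed.

Let g i := rotG z^-1 (w i) (th c' i).

Let equivariantE v : ZB_equivariant l z (mirror_cycle c) (u v) =
  \prod_i (cexp ((- (freq l v i * th c' i)) +i* (w i * th c' i)) *
    fourier (g i) (freq l v i)).
Proof.
rewrite /ZB_equivariant /form_integral /sign expr0 mul1r.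
have fi i : Cintegrable leb (rotE z^-1 (w i) (freq l v i) (th c i)).
  by have [w0 c0 _] := weight_cos i; exact: Cintegrable_rotE.
have [_ PE] := Cintegral_prod fi.
transitivity (Cintegral (mu (n + k)) (fun s =>
    \prod_i rotE z^-1 (w i) (freq l v i) (th c i) (tnth s i))).
  by apply: eq_Cintegral => s; rewrite /volume_form det1 mulr1 equivariant_integrandE.
rewrite PE; apply: eq_bigr => i _.
have [w0 c0 c0'] := weight_cos i.
by rewrite (Cintegral_rotE_shift _ iz0 w0 c0 c0' (th_close i)) Cintegral_rotE.
Qed.

Let kap : R := expR (- \sum_a gamma 0 a * cRe (t 0 a)).

Variable x0 : 'rV[R]_(n + k).
Hypothesis x0L : x0 *m mxR R l = map_mx (@complex.Re R) t.

(* The value of [Im t] enters here: the rotation brings in a factor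
   [exp (- sum_i freq_i th'_i)], which the modulus of [exp (- u.t)] cancels. *)
Let dual_sum (x : 'rV[R]_k) :
  \sum_i (x *m (mxR R l)^T) 0 i * th c' i = \sum_a x 0 a * cIm (t 0 a).
Proof.
under eq_bigr => i _ do rewrite mxE mulr_suml.
rewrite exchange_big; apply: eq_bigr => a _; rewrite ht !mulr_sumr.
by apply: eq_bigr => i _; rewrite !mxE /th; ring.
Qed.

Let fourier_integrandE v :
  fourier_integrand (ZB_equivariant l z (mirror_cycle c)) t (u v) *
    volume_form (frame (vertical_cycle gamma)) =
  ('i ^+ k * kap%:C) * slice_transform g (mxR R l) x0 v.
Proof.
rewrite /volume_form det_scalar [LHS]mulrC -mulrA; congr (_ * _).
rewrite /fourier_integrand equivariantE big_split/= -cexp_sum.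
rewrite /slice_transform [LHS]mulrAC [RHS]mulrCA mulrC; congr (_ * _).
rewrite -cexp_real -!cexpD; congr cexp; apply: eq_ReIm.
  rewrite !ReD ReN !Re_sum/= addr0 sumrN dual_sum.
  rewrite -opprD -big_split/=; congr (- _); apply: eq_bigr => a _.
  by rewrite /u vertical_cycleE Re_mul/= !mxE; ring.
rewrite !ImD ImN !Im_sum/= add0r dual_sum x0L -sumrN -sumrN -big_split/=.
apply: eq_bigr => a _.
by rewrite /u vertical_cycleE Im_mul/= !mxE; ring.
Qed.

Variables (V : 'M[R]_(n, n + k)) (W : 'M[R]_(k, n + k)).
Hypotheses (VL : V *m mxR R l = 0) (WL : W *m mxR R l = 1%:M)
  (uM : col_mx V W \in unitmx).

(** After rotating the contours from [c] to [c'], the integrand of the inverse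
    Fourier transform is a constant times a [slice_transform]. *)
Lemma inverse_fourier_slice :
  [/\ inverse_fourier_converges gamma (ZB_equivariant l z (mirror_cycle c)) t,
    Cintegrable (mu n) (fun y : tup n => \prod_i g i ((x0 + rowt y *m V) 0 i)) &
    inverse_fourier gamma (ZB_equivariant l z (mirror_cycle c)) t =
    `|\det (col_mx V W)|%:C * kap%:C *
    Cintegral (mu n) (fun y => \prod_i g i ((x0 + rowt y *m V) 0 i))].
Proof.
have [C [d [d0 H]]] : exists C d, 0 < d /\ forall i,
    (forall s, normc (g i s) <= C * expN d s) /\
    (forall tau, normc (fourier (g i) tau) <= C * expN d tau).
  apply: (uniform_decay (P := fun i C d =>
    (forall s, normc (g i s) <= C * expN d s) /\
    (forall tau, normc (fourier (g i) tau) <= C * expN d tau))).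
    move=> i C C' d d' CC dd d0 [h1 h2].
    have C0 : 0 <= C.
      by have := le_trans (normc_ge0 _) (h1 0); rewrite pmulr_lge0// expR_gt0.
    by split=> x; [apply: le_trans (h1 x) _|apply: le_trans (h2 x) _];
      exact: ler_expN.
  move=> i; have [w0 c0 c0'] := weight_cos i.
  have [C [d [d0 h]]] := fourier_rotG_decay iz0 w0 c0'.
  have C0 : 0 <= C.
    by have := le_trans (normc_ge0 _) (h 0); rewrite pmulr_lge0// expR_gt0.
  pose C2 := expR (4 * w i ^+ 2 / (z^-1 * cos (th c' i))).
  exists (Num.max C C2), (Num.min d (w i)); split; first by rewrite lt_min d0 w0.
  split=> x.
    apply: (le_trans (rotG_le x iz0 w0 c0')); apply: ler_expN.
    - exact: expR_ge0.
    - by rewrite le_max lexx orbT.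
    - by rewrite ge_min lexx orbT.
  apply: (le_trans (h x)); apply: ler_expN => //.
    by rewrite le_max lexx.
  by rewrite ge_min lexx.
have [iT iS E] := @slice_inversion R n k g C d d0
  (fun i => (continuous_rotG z^-1 (w i) (th c' i)).1)
  (fun i => (continuous_rotG z^-1 (w i) (th c' i)).2)
  (fun i => (H i).1) (fun i => (H i).2) _ _ _ VL WL uM x0.
split=> //.
  exact: eq_Cintegrable (fun v : tup k => esym (fourier_integrandE v))
    (CintegrableZ ('i ^+ k * kap%:C) iT).
rewrite /inverse_fourier /form_integral /sign expr0 mul1r.
transitivity ((0 +i* (2 * pi)) ^- k * Cintegral (mu k)
    (fun v => ('i ^+ k * kap%:C) * slice_transform g (mxR R l) x0 v)).
  by congr (_ * _); apply: eq_Cintegral => v; rewrite fourier_integrandE.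
rewrite CintegralZ// E rmorphM rmorphXn/=.
have -> : (0 +i* (2 * pi)) = 'i * (2 * pi)%:C :> R[i].
  by apply: eq_ReIm => /=; ring.
have i0 : ('i : R[i]) != 0.
  by apply/eqP => /(congr1 (fun x => cIm x)) /= /eqP; rewrite oner_eq0.
have p0 : (2 * pi)%:C != 0 :> R[i].
  by rewrite -[0]/((0 : R)%:C) (inj_eq (@complexI R)) mulf_neq0// gt_eqF// pi_gt0.
rewrite exprMn; field.
by rewrite !expf_neq0.
Qed.

End main.

Theorem proposition4p1 (R : realType) (n k r' : nat)
    (b : 'M[int]_(n + k, n)) (Sigma : {set {set 'I_(n + k)}})
    (p : 'I_k -> 'rV[int]_(n + k) -> int) (l : 'M[int]_(n + k, k))
    (htoric : toric_data R r' b Sigma p l)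
    (z : R) (hz : 0 < z)
    (c c' : 'rV[R]_(n + k))
    (hc : forall i, `|c' 0 i - c 0 i| < 4^-1)
    (t : 'rV[R[i]]_k)
    (ht : forall a,
      [/\ \sum_i (l i a)%:~R * (2 * pi * c 0 i - pi / 2) < complex.Im (t 0 a),
          complex.Im (t 0 a) = 2 * pi * \sum_i (l i a)%:~R * c' 0 i &
          complex.Im (t 0 a) <
            \sum_i (l i a)%:~R * (2 * pi * c 0 i + pi / 2)])
    (gamma : 'rV[R]_k) (hgamma : forall a, 0 < gamma 0 a)
    (hconv : forall u, locus (vertical_cycle gamma) u ->
      ZB_equivariant_converges l z (mirror_cycle c) u /\
      ZB_equivariant_converges l z (mirror_cycle c') u)
    (F : affine_cycle R n (n + k))
    (hF : locus F = locus (mirror_cycle c') `&`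
      \bigcap_(a in [set: 'I_k])
        [set x | complex.Re (Htilde l x 0 a) = complex.Re (t 0 a)])
    (horient : 0 < sign F * Omega l (frame F)) :
  [/\ inverse_fourier_converges gamma (ZB_equivariant l z (mirror_cycle c)) t,
      ZB_converges l z F &
      inverse_fourier gamma (ZB_equivariant l z (mirror_cycle c)) t =
      ZB l z F].
Proof.
have htI a : complex.Im (t 0 a) = 2 * pi * \sum_i (l i a)%:~R * c' 0 i.
  by have [] := ht a.
have x0L := cycle_base_image hF.
have VL := cycle_frame_tangent hF.
have [iF iS ->] := inverse_fourier_slice hz hc htI hconv x0L VL
  (cycle_section hF horient) (cycle_unit hF horient).
set G := (X in Cintegrable _ X) in iS *.
set kap := expR _.
(* [sum_i weight_i x_i] is constant on the fibre, equal to [gamma . Re t] *)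
have integrandE (y : n.-tuple (measurableTypeR R)) :
    ZB_integrand z (parametrization F y) * Omega l (frame F) =
    Omega l (frame F) * kap%:C * G y.
  rewrite (superpotential_integrandE l z gamma (cycle_pointE hF y)).
  rewrite mulrC mulrA; congr (_ * (expR (- _))%:C * _).
  apply: eq_bigr => a _.
  by rewrite mulmxDl x0L -mulmxA VL mulmx0 addr0 mxE.
split=> //.
  exact: eq_Cintegrable (fun y => esym (integrandE y)) (CintegrableZ _ iS).
rewrite /ZB /form_integral.
transitivity (sign F * Cintegral (lebesgue_tuple R n)
    (fun y => Omega l (frame F) * kap%:C * G y)); last first.
  by congr (_ * _); apply: eq_Cintegral => y; rewrite integrandE.
by rewrite CintegralZ// -(cycle_sign hF horient) !mulrA.
Qed.
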